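(* Let $N\ge 2$, let $\mu$ be a quasi-stationary Markov measure on $\mathcal K_N$ associated to $(\lambda,T)$, and let $(S_i)_{i\in\mathbb Z_N}$ be the corresponding representation of $\mathcal O_N$ on $L^2(\mu)$. Then: (i) The measure $\mu$ is ergodic with respect to the endomorphism $\sigma$. (ii) The representation $(S_i)_{i\in\mathbb Z_N}$ of $\mathcal O_N$ is irreducible.
   Context: $\mathbb N=\{1,2,\dots\}$, $\mathbb Z_N=\{0,1,\dots,N-1\}$, and $\mathcal K_N=\mathbb Z_N^{\mathbb N}$ is the set of infinite words $x_1x_2\dots$ over $\mathbb Z_N$, with the product topology and Borel sigma-algebra. The shift is $\sigma(x_1x_2\dots)=x_2x_3\dots$. For a finite word $I=i_1\dots i_n$, the cylinder set is $\mathcal C(I)=\{x\in\mathcal K_N:x_1=i_1,\dots,x_n=i_n\}$. Markov measures: a matrix is stochastic if each row sums to $1$. Let $\lambda=(\lambda_0,\dots,\lambda_{N-1})$ be a row vector with $\lambda_i>0$ and $\sum_i\lambda_i=1$, and let $T=\{T^{(n)}\}_{n\in\mathbb N}$ be a sequence of stochastic $N\times N$ matrices with $T^{(n)}_{i,j}>0$ for all $i,j\in\mathbb Z_N$, $n\in\mathbb N$, and such that $\lambda T^{(1)}=\lambda$. The Markov measure associated to $(\lambda,T)$ is the unique Borel probability measure $\mu$ on $\mathcal K_N$ with $$\mu(\mathcal C(i_1\dots i_n))=\lambda_{i_1}T^{(1)}_{i_1,i_2}T^{(2)}_{i_2,i_3}\cdots T^{(n-1)}_{i_{n-1},i_n}$$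 for all finite words. It is quasi-stationary if $$\sum_{n=1}^\infty\left|\frac{T^{(n)}_{x_n,x_{n+1}}}{T^{(n+1)}_{x_n,x_{n+1}}}-1\right|<\infty\quad\text{for all }x_1x_2\dots\in\mathcal K_N.$$ Associated representation: a representation of the Cuntz algebra $\mathcal O_N$ on a Hilbert space is given by operators $(S_i)_{i\in\mathbb Z_N}$ with $S_i^*S_j=\delta_{ij}I$ and $\sum_{i}S_iS_i^*=I$. The representation associated to (or corresponding to) the quasi-stationary Markov measure $\mu$ is the one on $L^2(\mu)$ given by $S_jf=f_j\,(f\circ\sigma)$, where $$f_j(x_1x_2\dots)=\delta_{j,x_1}\sqrt{\frac{\lambda_{x_2}}{\lambda_{x_1}T^{(1)}_{x_1,x_2}}F(x_2x_3\dots)},\qquad F(x_1x_2\dots)=\prod_{n=1}^\infty\frac{T^{(n)}_{x_n,x_{n+1}}}{T^{(n+1)}_{x_n,x_{n+1}}}$$ (the product converges to a number in $(0,\infty)$, and the $S_j$ do form a representation of $\mathcal O_N$). Ergodic with respect to $\sigma$ means: for every Borel set $A\subset\mathcal K_N$ with $\sigma^{-1}(A)=A$, either $\mu(A)=0$ or $\mu(\mathcal K_N\setminus A)=0$ ($\mu$ is not assumed $\sigma$-invariant). Irreducible means that the only closed subspaces invariant under all $S_i$ and $S_i^*$ are $\{0\}$ and the whole space. *)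

(* Defs.v *)
From HB Require Import structures.
From mathcomp Require Import all_boot all_order all_algebra.
From mathcomp Require Import complex.
From mathcomp Require Import all_classical all_reals all_analysis.

Set Implicit Arguments.
Unset Strict Implicit.
Unset Printing Implicit Defensive.

Import Order.TTheory GRing.Theory Num.Theory.
Import numFieldNormedType.Exports.

Local Open Scope classical_set_scope.
Local Open Scope ring_scope.

(* Indices start at 0: for a word [x], [x n] is the letter written x_(n+1), and
   for a sequence of matrices [T], [T n] is the matrix written T^(n+1).

   The proof [hN] is used only to exhibit a point of [words hN]: measurable
   types of the library are pointed. *)
Definition words (N : nat) (hN : (2 <= N)%N) : Type := nat -> 'I_N.

Section Words.
Context (N : nat) (hN : (2 <= N)%N).

HB.instance Definition _ := Choice.copy (words hN) (nat -> 'I_N).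
HB.instance Definition _ :=
  isPointed.Build (words hN) (fun=> Ordinal (ltnW hN)).
HB.instance Definition _ := Topological.copy (words hN)
  {ptws nat -> discrete_topology 'I_N}.
HB.instance Definition _ := Measurable.copy (words hN)
  (g_sigma_algebraType (@open (words hN))).

Definition word_shift (x : words hN) : words hN := fun n => x n.+1.

Definition cylinder n (I : n.-tuple 'I_N) : set (words hN) :=
  [set x | forall k : 'I_n, x k = tnth I k].

End Words.

Arguments cylinder {N} hN {n} I.

Section MarkovMeasure.
Context (R : realType) (N : nat) (hN : (2 <= N)%N).
Implicit Types (lambda : 'rV[R]_N) (T : nat -> 'M[R]_N).

Definition markov_data lambda T : Prop :=
  [/\ (forall i, 0 < lambda 0 i) /\ \sum_i lambda 0 i = 1,
      forall n i, \sum_j T n i j = 1,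
      forall n i j, 0 < T n i j
    & lambda *m T 0%N = lambda].

(* Two Borel probability measures with these values on cylinders are equal, so
   this determines [mu]. [widen_ord] and [lift ord0] select the consecutive
   positions k and k+1 of the word [I]. *)
Definition markov_measure lambda T (mu : probability (words hN) R) : Prop :=
  forall n (I : n.+1.-tuple 'I_N),
    mu (cylinder hN I) =
    (lambda 0 (tnth I ord0) *
     \prod_(k < n) T k (tnth I (widen_ord (leqnSn n) k))
                       (tnth I (lift ord0 k)))%:E.

Definition ratio T (x : words hN) (n : nat) : R :=
  T n (x n) (x n.+1) / T n.+1 (x n) (x n.+1).

Definition quasi_stationary T : Prop :=
  forall x : words hN, (\sum_(n <oo) `|ratio T x n - 1|%:E < +oo)%E.

Definition markov_F T (x : words hN) : R :=
  limn (fun n => \prod_(k < n) ratio T x k).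

Definition markov_f lambda T (j : 'I_N) (x : words hN) : R :=
  (j == x 0%N)%:R *
  Num.sqrt (lambda 0 (x 1%N) / (lambda 0 (x 0%N) * T 0%N (x 0%N) (x 1%N)) *
            markov_F T (word_shift x)).

Definition markov_S lambda T (j : 'I_N) (f : words hN -> R[i])
    (x : words hN) : R[i] :=
  (markov_f lambda T j x)%:C%C * f (word_shift x).

End MarkovMeasure.

Definition ergodic d (X : measurableType d) (R : realType)
    (mu : probability X R) (s : X -> X) : Prop :=
  forall A : set X, measurable A -> s @^-1` A = A ->
    mu A = 0%E \/ mu (~` A) = 0%E.

(* Elements of the complex Hilbert space L^2(mu) are given by representatives:
   square-integrable functions, without quotient by equality almost
   everywhere. *)
Section ComplexL2.
Context d (X : measurableType d) (R : realType).
Variable mu : {measure set X -> \bar R}.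
Implicit Types (f g h : X -> R[i]) (V : set (X -> R[i])).

Definition L2sqnorm f : \bar R :=
  (\int[mu]_x (complex.Re (f x) ^+ 2 + complex.Im (f x) ^+ 2)%:E)%E.

Definition L2fun : set (X -> R[i]) :=
  [set f | [/\ measurable_fun setT (fun x => complex.Re (f x)),
               measurable_fun setT (fun x => complex.Im (f x))
             & (L2sqnorm f < +oo)%E]].

(* The L^2 class of 0. *)
Definition L2_zero : set (X -> R[i]) :=
  [set f | L2fun f /\ {ae mu, forall x, f x = 0}].

Definition L2_inner f g : R[i] :=
  (Rintegral mu setT (fun x => complex.Re (f x * (g x)^*%C)) +i*
   Rintegral mu setT (fun x => complex.Im (f x * (g x)^*%C)))%C.

(* Closedness under L^2 limits of sequences makes [V] stable under equality
   almost everywhere (use constant sequences), so these sets are exactly the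
   preimages of the closed subspaces of the quotient. *)
Definition closed_subspace V : Prop :=
  [/\ V `<=` L2fun,
      V (fun=> 0),
      forall (a : R[i]) f g, V f -> V g -> V (fun x => a * f x + g x)
    & forall (u : nat -> X -> R[i]) f, (forall n, V (u n)) -> L2fun f ->
        L2sqnorm (fun x => u n x - f x) @[n --> \oo] --> 0%E -> V f].

(* [h] represents [S^* g]. *)
Definition is_adjoint_image (S : (X -> R[i]) -> X -> R[i]) g h : Prop :=
  L2fun h /\ forall f, L2fun f -> L2_inner (S f) g = L2_inner f h.

Definition irreducible_family (I : Type) (S : I -> (X -> R[i]) -> X -> R[i]) : Prop :=
  forall V, closed_subspace V ->
    (forall i f, V f -> V (S i f)) ->
    (forall i g h, V g -> is_adjoint_image (S i) g h -> V h) ->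
    V = L2_zero \/ V = L2fun.

End ComplexL2.

(* Main.v *)
(* Quasi-stationarity, applied to the periodic words ijij..., makes
   [sum_n |T n i j / T n.+1 i j - 1|] finite for every pair (i, j). Hence the
   entries of all [T n] are bounded below by a constant c > 0, and the products
   defining F are uniformly bounded above and below.

   Ergodicity. If s^-1 A = A, the conditional probability of A given a prefix of
   length n.+1 depends only on n and on the last letter i, say it is [h n i],
   and [h n i = sum_j T n i j * h n.+1 j]. As the entries of [T n] are at least
   c, the oscillation of [h n] is at most 1 - c times that of [h n.+1], hence it
   vanishes: A is independent of all cylinders, so of itself.

   Irreducibility. The image under the shift of the measure [f_j^2 mu] is [mu],
   which gives the formula for [S_j^*]. A closed invariant subspace V is then
   stable under the multiplication by indicators of cylinders, so of Borel sets.
   If g in V is not zero almost everywhere, V contains all square-integrable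
   functions that vanish outside A = {g <> 0}. The sets A with this last property
   are stable under countable unions, images and preimages by the shift, so V
   contains the functions vanishing outside an invariant set that contains A,
   which has full measure by ergodicity. *)
From HB Require Import structures.
From mathcomp Require Import finmap all_boot all_order all_algebra.
From mathcomp Require Import complex.
From mathcomp Require Import all_classical all_reals all_analysis.
From mathcomp Require Import measurable_realfun.
From mathcomp Require Import zify ring lra.
Require Import Defs.

Set Implicit Arguments.
Unset Strict Implicit.
Unset Printing Implicit Defensive.

Import Order.TTheory GRing.Theory Num.Theory.
Import numFieldNormedType.Exports.

Local Open Scope classical_set_scope.
Local Open Scope ring_scope.

(** * Elementary facts on R[i] and on the space of words *)

Section ComplexParts.
Variable R : rcfType.

Lemma ReCM (a : R) (z : R[i]) : complex.Re (a%:C%C * z) = a * complex.Re z.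
Proof. by case: z => u v /=; rewrite mul0r subr0. Qed.

Lemma ImCM (a : R) (z : R[i]) : complex.Im (a%:C%C * z) = a * complex.Im z.
Proof. by case: z => u v /=; rewrite mul0r addr0. Qed.

Lemma conjCM (a : R) (z : R[i]) : ((a%:C%C * z)^* = a%:C%C * z^*)%C.
Proof.
by case: z => u v; apply/eqP;
  rewrite eq_complex /= !mul0r !subr0 !addr0 mulrN !eqxx.
Qed.

End ComplexParts.

Section WordSpace.
Context (N : nat) (hN : (2 <= N)%N).
Local Notation words := (words hN).
Implicit Types (x y z : words).

Definition prefix_cyl x n : set words :=
  [set y | forall k, (k < n)%N -> y k = x k].

(** Otherwise points [y n] of the successive cylinders, chosen outside [U], would converge to [x]
    letter by letter, hence in the product topology, without entering [U]. *)
Lemma nbhs_prefix_cyl x (U : set words) : nbhs x U ->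
  exists n, prefix_cyl x n `<=` U.
Proof.
move=> xU; apply: contrapT => /forallNP noC.
have /choice[y yP] n : exists y, prefix_cyl x n y /\ ~ U y.
  have /existsNP[y /not_implyP[]] := noC n; by exists y.
have yx : y @ \oo --> x.
  apply/(@pointwise_cvgP _ (discrete_topology 'I_N)) => t.
  move=> B /= xB; exists t.+1 => // n /= tn.
  have -> : y n t = x t by apply: (yP n).1.
  exact: nbhs_singleton xB.
have [n _ /(_ n (leqnn _))] := yx U xU.
exact: (yP n).2.
Qed.

Lemma open_coord (k : nat) (i : 'I_N) : open [set y : words | y k = i].
Proof.
rewrite openE => x /= xk.
have /(@pointwise_cvgP _ (discrete_topology 'I_N)) : y @[y --> x] --> x.
  exact: cvg_id.
by move/(_ k [set i]); apply; rewrite -xk; exact: discrete_set1.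
Qed.

Lemma measurable_coord (k : nat) (i : 'I_N) :
  measurable [set y : words | y k = i].
Proof. by apply: sub_sigma_algebra; exact: open_coord. Qed.

Lemma measurable_prefix_cyl x n : measurable (prefix_cyl x n).
Proof.
have -> : prefix_cyl x n = \bigcap_(k in `I_n) [set y | y k = x k].
  by apply/seteqP; split => y /= h k; exact: h.
by apply: bigcap_measurableType => k _; exact: measurable_coord.
Qed.

(** The empty set makes the family stable under intersection: two cylinders are disjoint or
    nested. *)
Definition prefix_cyls : set (set words) :=
  [set A | A = set0 \/ exists x n, A = prefix_cyl x n].

Lemma prefix_cyl0 x : prefix_cyl x 0 = setT.
Proof. by apply/seteqP; split => // y _ k. Qed.

Lemma prefix_cyls_setI : setI_closed prefix_cyls.
Proof.
have sub x y m n z : (m <= n)%N -> prefix_cyl x m z -> prefix_cyl y n z ->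
    prefix_cyl x m `&` prefix_cyl y n = prefix_cyl y n.
  move=> mn xz yz; apply/seteqP; split => [t []//|t yt]; split => // k km.
  by rewrite yt ?(leq_trans km)// -yz ?(leq_trans km)// xz.
move=> A B [->|[x [m ->]]]; first by rewrite set0I; left.
move=> [->|[y [n ->]]]; first by rewrite setI0; left.
have [->|/set0P[z [xz yz]]] := eqVneq (prefix_cyl x m `&` prefix_cyl y n) set0.
  by left.
right; have [mn|/ltnW nm] := leqP m n.
  by exists y, n; exact: sub xz yz.
by exists x, m; rewrite setIC; exact: sub yz xz.
Qed.

(** There are countably many finite words, so an open set is the countable union of the cylinders
    that it contains. *)
Lemma measurable_prefix_cyls : @measurable _ words = <<s prefix_cyls >>.
Proof.
apply/seteqP; split; last first.
  apply: smallest_sub; first exact: sigma_algebra_measurable.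
  move=> _ [->|[x [n ->]]]; first exact: measurable0.
  exact: measurable_prefix_cyl.
apply: smallest_sub; first exact: smallest_sigma_algebra.
move=> U oU.
(* [c] runs through the codes of finite words; a number that is no code, or the code of a cylinder
   not contained in [U], contributes the empty set. *)
pose c (m : nat) : set words :=
  if (unpickle m : option {n : nat & n.-tuple 'I_N}) is Some J then
    if `[< cylinder hN (tagged J) `<=` U >] then cylinder hN (tagged J)
    else set0
  else set0.
have -> : U = \bigcup_m c m.
  apply/seteqP; split => x; last first.
    move=> [m _]; rewrite /c; case: unpickle => //= J.
    by case: asboolP => // + Jx; apply.
  move=> Ux; have /nbhs_prefix_cyl[n nU] : nbhs x U by exact: open_nbhs_nbhs.
  exists (pickle (Tagged (fun n => n.-tuple 'I_N) [tuple x i | i < n])) => //.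
  rewrite /c pickleK /=; case: asboolP => [_ k|]; first by rewrite tnth_mktuple.
  by case=> y Iy; apply: nU => k kn; rewrite (Iy (Ordinal kn)) tnth_mktuple.
have [s0 _ sU] := @smallest_sigma_algebra _ setT prefix_cyls.
apply: sU => m; rewrite /c; case: unpickle => [[n J]|//] /=.
case: asboolP => // _; apply: sub_sigma_algebra; right.
have i0 : 'I_N := Ordinal (ltnW hN).
exists (nth i0 J), n; apply/seteqP; split => x Jx k.
  by move=> kn; rewrite (Jx (Ordinal kn)) (tnth_nth i0).
by rewrite Jx// (tnth_nth i0).
Qed.

Lemma measure_unique_prefix_cyl (R : realType)
    (m1 m2 : {measure set words -> \bar R}) :
  (m1 setT < +oo)%E ->
  (forall x n, m1 (prefix_cyl x n) = m2 (prefix_cyl x n)) ->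
  forall A, measurable A -> m1 A = m2 A.
Proof.
move=> m1T m12 A; apply: (measure_unique prefix_cyls (fun=> setT)) => //.
- exact: measurable_prefix_cyls.
- exact: prefix_cyls_setI.
- by move=> _; right; exists point, 0%N; rewrite prefix_cyl0.
- by rewrite bigcup_const.
- by move=> _ [->|[x [n ->]]]; rewrite ?measure0.
Qed.

Lemma measurable_fun_words d (X : measurableType d) (f : X -> words) :
  (forall k i, measurable [set x | f x k = i]) -> measurable_fun setT f.
Proof.
move=> mf; apply: (@measurability _ _ _ _ _ _ prefix_cyls).
  exact: measurable_prefix_cyls.
move=> _ [_ [->|[x [n ->]]] <-]; first by rewrite preimage_set0 setI0.
rewrite setTI.
have -> : f @^-1` prefix_cyl x n = \bigcap_(k in `I_n) [set y | f y k = x k].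
  by apply/seteqP; split => y /= h k; exact: h.
by apply: bigcap_measurableType => k _; exact: mf.
Qed.

Lemma measurable_word_shift : measurable_fun setT (@word_shift N hN).
Proof. by apply: measurable_fun_words => k i; exact: measurable_coord. Qed.

Definition wcons (j : 'I_N) (x : words) : words :=
  fun n => if n is k.+1 then x k else j.

Lemma measurable_wcons j : measurable_fun setT (wcons j).
Proof.
apply: measurable_fun_words => -[|k] i; last exact: measurable_coord.
by have [->|/eqP ji] := eqVneq j i;
  [rewrite (_ : mkset _ = setT)//|rewrite (_ : mkset _ = set0)//];
  apply/seteqP; split.
Qed.

Lemma wcons_word_shift x : wcons (x 0%N) (word_shift x) = x.
Proof. by apply/funext => -[]. Qed.

End WordSpace.

(** * Uniform bounds from quasi-stationarity *)

Section QuasiStationary.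
Context (R : realType) (N : nat) (hN : (2 <= N)%N).
Local Notation words := (words hN).
Variable T : nat -> 'M[R]_N.
Hypothesis T1 : forall n i, \sum_j T n i j = 1.
Hypothesis T_gt0 : forall n i j, 0 < T n i j.
Hypothesis qsT : quasi_stationary hN T.

Lemma ratio_gt0 (x : words) n : 0 < ratio T x n.
Proof. by rewrite divr_gt0. Qed.

Definition max_dev (n : nat) : R :=
  \sum_i \sum_j `|T n i j / T n.+1 i j - 1|.

Lemma max_dev_ge (n : nat) i j : `|T n i j / T n.+1 i j - 1| <= max_dev n.
Proof.
rewrite /max_dev (bigD1 i)//= (bigD1 j)//= -addrA lerDl addr_ge0//.
  by apply: sumr_ge0.
by apply: sumr_ge0 => k _; apply: sumr_ge0.
Qed.

Lemma quasi_stationary_bounded (x : words) :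
  exists M, forall n, \sum_(k < n) `|ratio T x k - 1| <= M.
Proof.
have s0 : (0 <= \sum_(n <oo) `|ratio T x n - 1|%:E)%E.
  by apply: nneseries_ge0 => k _ _; rewrite lee_fin.
exists (fine (\sum_(n <oo) `|ratio T x n - 1|%:E)%E) => n.
rewrite -lee_fin fineK; last by rewrite ge0_fin_numE// qsT.
rewrite -sumEFin -(big_mkord xpredT (fun k => `|ratio T x k - 1|%:E)).
by apply: nneseries_lim_ge => k _ _; rewrite lee_fin.
Qed.

(* The hypothesis only speaks of one word at a time; a pair (i, j) occurs at the
   even positions of the word ijij... and at the odd positions of jiji... *)
Definition alternating i j : words := fun n => if odd n then j else i.

Lemma max_dev_bounded :
  exists2 E, 0 <= E & forall n, \sum_(k < n) max_dev k <= E.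
Proof.
have /choice[M MP] (p : 'I_N * 'I_N) :=
  quasi_stationary_bounded (alternating p.1 p.2).
exists (\sum_i \sum_j (M (i, j) + M (j, i))).
  apply: sumr_ge0 => i _; apply: sumr_ge0 => j _.
  by have := lerD (MP (i, j) 0%N) (MP (j, i) 0%N); rewrite !big_ord0 addr0.
move=> n; rewrite exchange_big/=; apply: ler_sum => i _.
rewrite exchange_big/=; apply: ler_sum => j _.
apply: le_trans (lerD (MP (i, j) n) (MP (j, i) n)).
rewrite -big_split/=; apply: ler_sum => k _.
(* At each position exactly one of the two words reads [i] then [j]; the deviation of the other is
   nonnegative and only enlarges the bound. *)
rewrite /ratio /alternating /=; case: (odd k) => /=.
  by rewrite lerDr.
by rewrite lerDl.
Qed.

Lemma prod_le_expR_sum (a b : nat -> R) n :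
  (forall k, 0 <= a k) -> (forall k, a k - 1 <= b k) ->
  \prod_(k < n) a k <= expR (\sum_(k < n) b k).
Proof.
move=> a0 ab; rewrite expR_sum; apply: ler_prod => k _; rewrite a0/=.
by apply: le_trans (expR_ge1Dx _); rewrite addrC -lerBlDr.
Qed.

(** The product of the first [n] ratios at [(i, j)] telescopes to [T 0 i j / T n i j] and is at most
    [expR E], so no entry falls below the least entry of [T 0] divided by [expR E]. *)
Lemma quasi_stationary_ge : exists2 c, 0 < c & forall n i j, c <= T n i j.
Proof.
have [E E0 bE] := max_dev_bounded.
exists ((\big[Order.min/1]_(p : 'I_N * 'I_N) T 0%N p.1 p.2) / expR E).
  by rewrite divr_gt0 ?expR_gt0//; apply: lt_bigmin.
move=> n i j; rewrite ler_pdivrMr ?expR_gt0//.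
apply: (@le_trans _ _ (T 0%N i j)).
  exact: (bigmin_le _ (i, j)).
have -> : T 0%N i j = T n i j * \prod_(k < n) (T k i j / T k.+1 i j).
  elim: n => [|n IH]; first by rewrite big_ord0 mulr1.
  by rewrite big_ord_recr/= mulrCA [_ * (_ / _)]mulrC divfK ?gt_eqF// mulrC.
rewrite ler_pM2l//; apply: le_trans (_ : expR (\sum_(k < n) max_dev k) <= _).
  apply: (@prod_le_expR_sum (fun k => T k i j / T k.+1 i j)) => k.
    by rewrite divr_ge0// ltW.
  exact: le_trans (ler_norm _) (max_dev_ge _ _ _).
by rewrite ler_expR.
Qed.

Lemma ratio_prod_bounded : exists m M, [/\ 0 < m, 0 < M,
  forall (x : words) n, m <= \prod_(k < n) ratio T x k <= M
  & forall x : words, cvgn (fun n => \prod_(k < n) ratio T x k)].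
Proof.
have [E E0 bE] := max_dev_bounded.
have [c c0 cT] := quasi_stationary_ge.
have rdev (x : words) k : `|ratio T x k - 1| <= max_dev k by exact: max_dev_ge.
have Tle1 n i j : T n i j <= 1.
  by rewrite -(T1 n i) (bigD1 j)//= lerDl sumr_ge0// => k _; rewrite ltW.
have rc (x : words) k : c <= ratio T x k.
  by rewrite /ratio ler_pdivlMr// (le_trans _ (cT k _ _))// ler_piMr// ltW.
have upper (x : words) n : \prod_(k < n) ratio T x k <= expR E.
  apply: (@le_trans _ _ (expR (\sum_(k < n) max_dev k))); last first.
    by rewrite ler_expR.
  apply: (@prod_le_expR_sum (ratio T x)) => k; first by rewrite ltW ?ratio_gt0.
  exact: le_trans (ler_norm _) (rdev _ _).
(* The exponential bound is applied to the inverse ratios: since [c <= ratio T x k], their deviation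
   from 1 is at most [max_dev k / c]. *)
have lower (x : words) n : expR (- (E / c)) <= \prod_(k < n) ratio T x k.
  rewrite expRN -[leRHS]invrK lef_pV2 ?posrE ?expR_gt0//; last first.
    by rewrite invr_gt0 prodr_gt0// => k _; exact: ratio_gt0.
  rewrite -prodfV.
  apply: (@le_trans _ _ (expR (\sum_(k < n) max_dev k / c))); last first.
    by rewrite ler_expR -mulr_suml ler_pM2r ?invr_gt0.
  apply: (@prod_le_expR_sum (fun k => (ratio T x k)^-1)
    (fun k => max_dev k / c)) => k.
    by rewrite invr_ge0 ltW ?ratio_gt0.
  have r0 := ratio_gt0 x k.
  have -> : (ratio T x k)^-1 - 1 = (1 - ratio T x k) / ratio T x k.
    by rewrite mulrBl mul1r divff ?gt_eqF.
  apply: (@le_trans _ _ (`|1 - ratio T x k| / ratio T x k)).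
    by rewrite ler_pM2r ?invr_gt0// ler_norm.
  by rewrite distrC ler_pM ?invr_ge0 ?(ltW r0)// lef_pV2.
exists (expR (- (E / c))), (expR E); split; rewrite ?expR_gt0//.
  by move=> x n; rewrite lower upper.
(* The increment of the partial products at [k] is [P k] times [ratio T x k - 1], so the increments
   are absolutely summable. *)
move=> x; pose P n := \prod_(k < n) ratio T x k.
pose u n := P n.+1 - P n.
have -> : (fun n => \prod_(k < n) ratio T x k) = cst 1 \+ series u.
  apply/funext => n; rewrite /= /series /= /u telescope_sumr// {2}/P big_ord0.
  by rewrite addrC subrK.
apply: is_cvgD; first exact: is_cvg_cst.
apply: normed_cvg; apply: nondecreasing_is_cvgn.
  by apply: nondecreasing_series => k _ _; exact: normr_ge0.
exists (expR E * E) => _ [n _ <-]; rewrite /normed_series_of /series /= big_mkord.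
apply: (@le_trans _ _ (expR E * \sum_(k < n) max_dev k)); last first.
  by rewrite ler_pM2l ?expR_gt0.
rewrite mulr_sumr; apply: ler_sum => k _.
rewrite /u /P big_ord_recr/= -[X in _ - X]mulr1 -mulrBr normrM ler_pM//.
by rewrite ger0_norm ?upper// (le_trans (expR_ge0 _) (lower x k)).
Qed.

End QuasiStationary.

(** * Images of measures with density *)

Section WeightedImage.
Context d d' (X : measurableType d) (Y : measurableType d') (R : realType).
Variables (mu : {measure set X -> \bar R}) (s : X -> Y) (rho : X -> R).
Hypotheses (ms : measurable_fun setT s) (mrho : measurable_fun setT rho).
Hypothesis rho0 : forall x, 0 <= rho x.

Definition weighted_image_fun (A : set Y) : \bar R :=
  (\int[mu]_(x in s @^-1` A) (rho x)%:E)%E.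

Let wi0 : weighted_image_fun set0 = 0%E.
Proof. by rewrite /weighted_image_fun preimage_set0 integral_set0. Qed.

Let wi_ge0 A : (0 <= weighted_image_fun A)%E.
Proof. by apply: integral_ge0 => x _; rewrite lee_fin. Qed.

Let mpre A : measurable A -> measurable (s @^-1` A).
Proof. by move=> mA; rewrite -[X in measurable X]setTI; exact: ms. Qed.

Let wi_sigma_additive : semi_sigma_additive weighted_image_fun.
Proof.
move=> F mF tF mUF; rewrite /weighted_image_fun preimage_bigcup.
have := @semi_sigma_additive_nng_induced _ _ _ mu (EFin \o rho).
apply => //.
- exact/measurable_EFinP.
- by move=> n; exact: mpre.
- apply/trivIsetP => i j _ _ ij; rewrite -preimage_setI.
  by move/trivIsetP : tF => /(_ _ _ _ _ ij) ->//; rewrite preimage_set0.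
- by rewrite -preimage_bigcup; exact: mpre.
Qed.

Definition weighted_image : {measure set Y -> \bar R} :=
  HB.pack weighted_image_fun
    (isMeasure.Build _ _ _ weighted_image_fun wi0 wi_ge0 wi_sigma_additive).

Lemma weighted_imageE A :
  weighted_image A = (\int[mu]_(x in s @^-1` A) (rho x)%:E)%E.
Proof. by []. Qed.

Lemma weighted_image_indicE A : measurable A ->
  weighted_image A = (\int[mu]_x (rho x * \1_A (s x))%:E)%E.
Proof.
move=> mA; rewrite weighted_imageE integral_mkcond/=.
apply: eq_integral => x _; rewrite patchE indicE /=.
have -> : (x \in s @^-1` A) = (s x \in A) by apply/idP/idP; rewrite !inE.
by case: ifPn; rewrite ?mulr1 ?mulr0.
Qed.

Import HBNNSimple.

(** Change of variables, for simple functions by linearity and then by monotone convergence.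
    Agreement of [nu] with the image is asked on measurable sets only, so that [mu] itself can later
    be taken for [nu]. *)
Lemma ge0_integral_weighted_image (nu : {measure set Y -> \bar R})
    (G : Y -> \bar R) :
  (forall A, measurable A -> weighted_image A = nu A) ->
  measurable_fun setT G -> (forall y, 0 <= G y)%E ->
  (\int[mu]_x ((rho x)%:E * G (s x)) = \int[nu]_y G y)%E.
Proof.
move=> nuE mG G0.
have mterm (g : {nnsfun Y >-> R}) :
    measurable_fun setT (fun x => ((rho x)%:E * (g (s x))%:E)%E).
  apply: emeasurable_funM; apply/measurable_EFinP => //.
  exact: measurableT_comp.
have step (g : {nnsfun Y >-> R}) :
    (\int[mu]_x ((rho x)%:E * (g (s x))%:E) = \int[nu]_y (g y)%:E)%E.
  under [RHS]eq_integral do rewrite fimfunE -fsumEFin//.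
  rewrite [RHS]ge0_integral_fsum//; last 2 first.
    - by move=> r; exact/measurable_EFinP/measurableT_comp.
    - by move=> n x _; rewrite EFinM nnfun_muleindic_ge0.
  under [LHS]eq_integral.
    move=> x xD; rewrite fimfunE -fsumEFin// ge0_mule_fsumr; last first.
      by move=> r; rewrite EFinM nnfun_muleindic_ge0.
    over.
  rewrite [LHS]ge0_integral_fsum//; last 2 first.
    - move=> r; apply: emeasurable_funM; apply/measurable_EFinP => //.
      by apply: measurable_funM => //; apply: measurableT_comp => //;
        exact: measurable_indic.
    - move=> n x _; rewrite mule_ge0// ?lee_fin//.
      by rewrite -lee_fin EFinM nnfun_muleindic_ge0.
  apply: eq_fsbigr => r _.
  rewrite integralZl_indic_nnsfun// integral_indic// setIT -nuE//.
  (* A negative [r] is not a value of [g]: its fibre is empty and both terms vanish. *)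
  have [r0|r0] := leP 0 r; last first.
    rewrite (_ : g @^-1` [set r] = set0) ?measure0 ?mule0.
      by apply: integral0_eq => x _; rewrite indic0 mulr0 mule0.
    apply/seteqP; split => // y /= gyr; move: r0; rewrite -gyr ltNge.
    by rewrite fun_ge0.
  rewrite weighted_image_indicE// -ge0_integralZl//.
  - by apply: eq_integral => x _; rewrite -!EFinM mulrCA.
  - apply/measurable_EFinP/measurable_funM => //.
    by apply: measurableT_comp => //; exact: measurable_indic.
  - by move=> x _; rewrite lee_fin mulr_ge0.
pose g_ := nnsfun_approx measurableT mG.
transitivity (limn (fun n => \int[mu]_x ((rho x)%:E * (g_ n (s x))%:E)))%E.
  rewrite -monotone_convergence//=.
  - apply: eq_integral => x _; apply/esym/cvg_lim => //=.
    apply: cvgeZl => //.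
    exact: (cvg_nnsfun_approx measurableT mG (fun y _ => G0 y)).
  - by move=> n x _; rewrite mule_ge0// lee_fin.
  - move=> x _ m n mn; rewrite lee_wpmul2l ?lee_fin//.
    exact/lefP/nd_nnsfun_approx.
under eq_fun do rewrite step.
rewrite -monotone_convergence//=.
- apply: eq_integral => y _; apply/cvg_lim => //=.
  exact: (cvg_nnsfun_approx measurableT mG (fun y _ => G0 y)).
- by move=> n; exact/measurable_EFinP/measurable_funTS.
- by move=> n x _; rewrite lee_fin.
- move=> x _ m n mn; rewrite lee_fin.
  exact/lefP/nd_nnsfun_approx.
Qed.

Lemma integral_weighted_image (nu : {measure set Y -> \bar R}) (G : Y -> R) :
  (forall A, measurable A -> weighted_image A = nu A) ->
  measurable_fun setT G ->
  (\int[mu]_x (rho x * G (s x))%:E = \int[nu]_y (G y)%:E)%E.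
Proof.
move=> nuE mG; rewrite integralE [RHS]integralE; congr (_ - _)%E.
  rewrite -(ge0_integral_weighted_image nuE)//; last first.
    by apply: measurable_funepos; exact/measurable_EFinP.
  by apply: eq_integral => x _; rewrite !funeposE EFinM maxeMr ?lee_fin// mule0.
rewrite -(ge0_integral_weighted_image nuE)//; last first.
  by apply: measurable_funeneg; exact/measurable_EFinP.
apply: eq_integral => x _.
by rewrite !funenegE EFinM -muleN maxeMr ?lee_fin// mule0.
Qed.

End WeightedImage.

(** * Ergodicity *)

Section MarkovErgodic.
Context (R : realType) (N : nat) (hN : (2 <= N)%N).
Local Notation words := (words hN).
Variables (lambda : 'rV[R]_N) (T : nat -> 'M[R]_N).
Variable mu : probability words R.
Hypothesis data : markov_data lambda T.
Hypothesis muP : markov_measure lambda T mu.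

(** The index [n] counts transitions, so this is the mass of a cylinder of length [n.+1]. *)
Definition weight (x : words) (n : nat) : R :=
  lambda 0 (x 0%N) * \prod_(k < n) T k (x k) (x k.+1).

Lemma weight_gt0 x n : 0 < weight x n.
Proof.
have [[l0 _] _ T0 _] := data.
by rewrite mulr_gt0//; apply: prodr_gt0.
Qed.

Lemma weightS x n : weight x n.+1 = weight x n * T n (x n) (x n.+1).
Proof. by rewrite /weight big_ord_recr/= mulrA. Qed.

Lemma mu_prefix_cyl x n : mu (prefix_cyl x n.+1) = (weight x n)%:E.
Proof.
have -> : prefix_cyl x n.+1 = cylinder hN [tuple x i | i < n.+1].
  apply/seteqP; split => y h.
    by move=> k; rewrite tnth_mktuple h.
  by move=> k kn; rewrite (h (Ordinal kn)) tnth_mktuple.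
rewrite muP tnth_mktuple; congr (_ * _)%:E.
by apply: eq_bigr => k _; rewrite !tnth_mktuple.
Qed.

Lemma measure_coord_split (m : {measure set words -> \bar R}) A k :
  measurable A -> m A = (\sum_(j < N) m (A `&` [set y | y k = j]))%E.
Proof.
move=> mA; rewrite -measure_bigsetU_ord//.
- congr (m _); rewrite -bigcup_seq; apply/seteqP; split => y.
    by move=> Ay; exists (y k) => //=; exact: mem_index_enum.
  by move=> [j _ [//]]; case.
- by move=> j; apply: measurableI => //; exact: measurable_coord.
- by apply/trivIsetP => i j _ _ ij; rewrite -subset0 => y [[_ yi] [_ yj]];
  move/eqP : ij; apply; rewrite -yi -yj.
Qed.

Definition set_letter (x : words) n (j : 'I_N) : words :=
  fun k => if k == n then j else x k.

Lemma prefix_cyl_set_letter x n j :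
  prefix_cyl x n `&` [set y | y n = j] = prefix_cyl (set_letter x n j) n.+1.
Proof.
apply/seteqP; split => y.
  move=> [xy /= yn] k; rewrite ltnS leq_eqVlt /set_letter.
  by case: eqP => [-> _|_ /= kn]; [|exact: xy].
move=> xy; split => [k kn|]; last by rewrite /= xy// /set_letter eqxx.
by rewrite xy ?ltnS 1?ltnW// /set_letter lt_eqF.
Qed.

(** * Concatenation of words and the Markov property *)

Definition wcat (p : words) n (z : words) : words :=
  fun k => if (k < n)%N then p k else z (k - n)%N.

Lemma iter_shiftE n (x : words) k : iter n (@word_shift N hN) x k = x (n + k)%N.
Proof.
elim: n k => [//|n IH] k; rewrite iterS /word_shift IH.
by rewrite addSnnS.
Qed.

Lemma measurable_iter_shift n : measurable_fun setT (iter n (@word_shift N hN)).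
Proof.
apply: measurable_fun_words => k i.
rewrite (_ : mkset _ = [set x | x (n + k)%N = i]); first exact: measurable_coord.
by apply/seteqP; split => x /=; rewrite iter_shiftE.
Qed.

Lemma prefix_cyl_wcat p n z m :
  prefix_cyl p n `&` iter n (@word_shift N hN) @^-1` prefix_cyl z m =
  prefix_cyl (wcat p n z) (n + m).
Proof.
apply/seteqP; split => y.
  move=> [py zy] k knm; rewrite /wcat; case: ltnP => kn; first exact: py.
  by rewrite -zy ?iter_shiftE ?subnKC// ltn_subLR.
move=> h; split => k km.
  by rewrite h ?ltn_addr// /wcat km.
by rewrite iter_shiftE h ?ltn_add2l// /wcat ltnNge leq_addr/= addKn.
Qed.

(** The factor gained when [z] is appended to a prefix depends on the prefix only through its last
    letter; cross-multiplication avoids the quotients. *)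
Lemma weight_wcat (p q : words) n z m : p n = q n ->
  weight q n * weight (wcat p n.+1 z) (n.+1 + m) =
  weight p n * weight (wcat q n.+1 z) (n.+1 + m).
Proof.
move=> pq.
have pre (u : words) : weight (wcat u n.+1 z) n = weight u n.
  rewrite /weight /wcat /=; congr (_ * _); apply: eq_bigr => k _.
  by rewrite !ltnS ltn_ord (ltnW (ltn_ord k)).
elim: m => [|m IH].
  rewrite addn0 !weightS !pre /wcat !ltnSn ltnn pq.
  exact: mulrCA.
rewrite addnS; have : (n < n.+1 + m)%N by rewrite leq_addr.
move: (n.+1 + m)%N IH => l IH nl; rewrite !weightS [LHS]mulrA IH -[LHS]mulrA.
have [h h'] : (l < n.+1)%N = false /\ (l.+1 < n.+1)%N = false by split; lia.
by rewrite /wcat h h'.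
Qed.

(** As functions of [A], both sides are finite measures, and they agree on cylinders by
    [weight_wcat]. *)
Lemma markov_property (p q : words) n A : measurable A -> p n = q n ->
  ((weight q n)%:E * mu (prefix_cyl p n.+1 `&`
     iter n.+1 (@word_shift N hN) @^-1` A) =
   (weight p n)%:E * mu (prefix_cyl q n.+1 `&`
     iter n.+1 (@word_shift N hN) @^-1` A))%E.
Proof.
move=> mA pq; set s := iter n.+1 _.
have ms : measurable_fun setT s by exact: measurable_iter_shift.
have ms' B : measurable B -> measurable (s @^-1` B).
  by move=> mB; rewrite -[X in measurable X]setTI; exact: ms.
(* With this density, a constant times an indicator, the two sides become image measures under
   [s]. *)
pose rho (a : R) (u x : words) : R := a * \1_(prefix_cyl u n.+1) x.
have mrho a u : measurable_fun setT (rho a u).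
  apply: measurable_funM => //; apply: measurable_indic.
  exact: measurable_prefix_cyl.
have rho0 u v x : 0 <= rho (weight v n) u x.
  by rewrite mulr_ge0// ltW// weight_gt0.
pose m1 u v := weighted_image mu ms (mrho (weight v n) u) (rho0 u v).
have m1E u v B : measurable B ->
    m1 u v B = ((weight v n)%:E * mu (prefix_cyl u n.+1 `&` s @^-1` B))%E.
  move=> mB; rewrite weighted_imageE; under eq_integral do rewrite EFinM.
  rewrite ge0_integralZl//; last 3 first.
  - exact: ms'.
  - apply/measurable_EFinP; apply: measurable_indic.
    exact: measurable_prefix_cyl.
  - by rewrite lee_fin ltW// weight_gt0.
  by rewrite integral_indic//; [exact: ms'|exact: measurable_prefix_cyl].
rewrite -(m1E p q)// -(m1E q p)//.
apply: measure_unique_prefix_cyl => //.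
  rewrite m1E// (le_lt_trans (y := (weight q n)%:E * 1)%E)//; last first.
    by rewrite mule1 ltry.
  rewrite lee_wpmul2l// ?lee_fin ?(ltW (weight_gt0 _ _))// probability_le1//.
  by apply: measurableI; [exact: measurable_prefix_cyl|exact: ms'].
move=> z [|m].
  rewrite !prefix_cyl0 !m1E// preimage_setT !setIT !mu_prefix_cyl.
  by rewrite -!EFinM mulrC.
rewrite !m1E ?prefix_cyl_wcat; [|exact: measurable_prefix_cyl..].
by rewrite addnS !mu_prefix_cyl -!EFinM (weight_wcat _ _ pq).
Qed.

(** The difference of the two means is the mean of [h j - h k] for the product weights [p j * q k].
    The diagonal terms vanish, and for fixed [j] the mass of the other [k] is [1 - q j], at most
    [1 - c]. *)
Lemma stochastic_contraction (p q h : 'I_N -> R) (c d : R) :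
  (forall j, 0 <= p j) -> \sum_j p j = 1 ->
  (forall j, c <= q j) -> (forall j, 0 <= q j) -> \sum_j q j = 1 ->
  (forall j k, `|h j - h k| <= d) ->
  `|\sum_j p j * h j - \sum_j q j * h j| <= (1 - c) * d.
Proof.
move=> p0 p1 qc q0 q1 hd.
have d0 : 0 <= d := le_trans (normr_ge0 _) (hd (Ordinal (ltnW hN)) (Ordinal hN)).
have -> : \sum_j p j * h j - \sum_j q j * h j =
    \sum_j p j * \sum_k q k * (h j - h k).
  have -> : \sum_j q j * h j = \sum_j p j * \sum_k q k * h k.
    by rewrite -mulr_suml p1 mul1r.
  rewrite -sumrB; apply: eq_bigr => j _.
  rewrite -mulrBr; congr (_ * _).
  by under [RHS]eq_bigr do rewrite mulrBr; rewrite sumrB -mulr_suml q1 mul1r.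
have -> : (1 - c) * d = \sum_j p j * ((1 - c) * d).
  by rewrite -mulr_suml p1 mul1r.
apply: le_trans (ler_norm_sum _ _ _) _; apply: ler_sum => j _.
rewrite normrM ger0_norm// ler_wpM2l//.
rewrite (bigD1 j)//= subrr mulr0 add0r.
apply: le_trans (ler_norm_sum _ _ _) _.
apply: (@le_trans _ _ (\sum_(k | k != j) q k * d)).
  by apply: ler_sum => k _; rewrite normrM ger0_norm// ler_wpM2l.
rewrite -mulr_suml ler_wpM2r//.
by rewrite lerBrDr -[leRHS]q1 [leRHS](bigD1 j)//= [leLHS]addrC lerD2r.
Qed.

Lemma eq_of_geometric_bound (x y z : R) : 0 <= z < 1 ->
  (forall m, `|x - y| <= z ^+ m) -> x = y.
Proof.
move=> /andP[z0 z1] h; apply/eqP; rewrite -subr_eq0 -normr_le0.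
have zc : z ^+ m @[m --> \oo] --> (0 : R) by apply: cvg_expr; rewrite ger0_norm.
rewrite -(cvg_lim _ zc)//; apply: limr_ge; first by apply/cvg_ex; exists 0.
by apply: nearW.
Qed.

(** * Conditional probabilities of an invariant set *)

Variable c : R.
Hypotheses (c0 : 0 < c) (cT : forall n i j, c <= T n i j).

Lemma invariant_independent A B : measurable A -> measurable B ->
  @word_shift N hN @^-1` A = A -> mu (B `&` A) = (mu A * mu B)%E.
Proof.
move=> mA mB sA.
have [[l0 l1] T1 T0 _] := data.
have sAn n : iter n (@word_shift N hN) @^-1` A = A.
  elim: n => [|n IH]; first by [].
  by rewrite -[LHS]/(iter n _ @^-1` (@word_shift N hN @^-1` A)) sA.
pose P (C : set words) : R := fine (mu C).
have PK C : measurable C -> mu C = (P C)%:E.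
  by move=> mC; rewrite fineK// fin_num_measure.
have mcyl x n : measurable (prefix_cyl x n `&` A).
  by apply: measurableI => //; exact: measurable_prefix_cyl.
(* The conditional probability is computed on the constant word [i]; [hE] extends it, by the Markov
   property, to every prefix that ends with [i]. *)
pose h n i : R :=
  P (prefix_cyl ((fun=> i) : words) n.+1 `&` A) / weight (fun=> i) n.
have hE p n : P (prefix_cyl p n.+1 `&` A) = weight p n * h n (p n).
  have := @markov_property p (fun=> p n) n A mA erefl.
  rewrite sAn !PK// -!EFinM => -[e].
  apply: (mulfI (lt0r_neq0 (weight_gt0 (fun=> p n) n))).
  rewrite e /h [RHS]mulrCA; congr (_ * _).
  by rewrite mulrC divfK// gt_eqF// weight_gt0.
have split_cyl p n : P (prefix_cyl p n `&` A) =
    \sum_j P (prefix_cyl (set_letter p n j) n.+1 `&` A).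
  apply: EFin_inj; rewrite -PK// (@measure_coord_split _ _ n)// -sumEFin.
  apply: eq_bigr => j _; rewrite -PK//; congr (mu _).
  by rewrite -prefix_cyl_set_letter setIAC.
have wset p n j : weight (set_letter p n.+1 j) n.+1 = weight p n * T n (p n) j.
  rewrite weightS /set_letter eqxx ltn_eqF//; congr (_ * _).
  rewrite /weight /=; congr (_ * _); apply: eq_bigr => k _.
  by rewrite !ltn_eqF// ltnS ?(ltnW (ltn_ord k)).
have hS n i : h n i = \sum_j T n i j * h n.+1 j.
  apply: (mulfI (lt0r_neq0 (weight_gt0 (fun=> i) n))).
  rewrite -(hE (fun=> i)) split_cyl mulr_sumr; apply: eq_bigr => j _.
  by rewrite hE wset /set_letter eqxx -mulrA.
have h01 n i : 0 <= h n i <= 1.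
  have w0 := weight_gt0 (fun=> i) n.
  rewrite divr_ge0 ?fine_ge0 ?(ltW w0)//= ler_pdivrMr// mul1r.
  rewrite -lee_fin -PK// -mu_prefix_cyl; apply: le_measure; rewrite ?inE//.
  exact: measurable_prefix_cyl.
(* The recursion goes from [n] to [n.+1], so it can be iterated any number [m] of times from a fixed
   [n], starting from the trivial bound 1. *)
have hosc m n i j : `|h n i - h n j| <= (1 - c) ^+ m.
  elim: m n i j => [|m IH] n i j.
    have /andP[? ?] := h01 n i; have /andP[? ?] := h01 n j.
    by rewrite expr0 ler_norml; apply/andP; split; lra.
  rewrite !hS exprS; apply: stochastic_contraction => // k; exact: ltW.
have cle1 : c <= 1.
  have i0 := Ordinal (ltnW hN).
  rewrite (le_trans (cT 0%N i0 i0))// -(T1 0%N i0) [leRHS](bigD1 i0)//= lerDl.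
  by apply: sumr_ge0 => k _; exact: ltW.
have hcst n i j : h n i = h n j.
  apply: (@eq_of_geometric_bound _ _ (1 - c)) => [|m]; last exact: hosc.
  by rewrite subr_ge0 cle1 ltrBlDr ltrDl c0.
have i0 : 'I_N := Ordinal (ltnW hN).
(* Once [h n.+1] does not depend on the letter, its mean along a row of [T n] is its common value,
   so [h] does not depend on [n] either. *)
have hE0 n i : h n i = h 0%N i0.
  elim: n i => [|n IH] i; first exact: hcst.
  rewrite -(IH i0) [RHS]hS; under eq_bigr do rewrite (hcst _ _ i).
  by rewrite -mulr_suml T1 mul1r.
have PA : P A = h 0%N i0.
  have := split_cyl (fun=> i0) 0%N; rewrite prefix_cyl0 setTI => ->.
  under eq_bigr do rewrite hE hE0 /weight big_ord0 mulr1 /set_letter eqxx.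
  by rewrite -mulr_suml l1 mul1r.
have P0 : 0 <= P A by apply: fine_ge0.
rewrite (PK A)//.
apply: (@measure_unique_prefix_cyl N hN R (mrestr mu mA)
  (mscale (NngNum P0) mu)) => //.
- by rewrite /= /mrestr setTI PK// ltry.
- move=> x [|n]; rewrite /= /mrestr /mscale /=.
    by rewrite prefix_cyl0 setTI probability_setT mule1 PK.
  by rewrite mu_prefix_cyl PK// hE hE0 PA -EFinM mulrC.
Qed.

(** An invariant set is independent of its complement, which is disjoint from it, so one of the two
    masses is zero. *)
Lemma markov_ergodic : ergodic mu (@word_shift N hN).
Proof.
move=> A mA sA; have /esym := invariant_independent mA (measurableC mA) sA.
rewrite setICl measure0 => /eqP; rewrite mule_eq0.
by move=> /orP[]/eqP; [left|right].
Qed.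

End MarkovErgodic.

(** * The density of the shift and the adjoint operators *)

Section ShiftDensity.
Context (R : realType) (N : nat) (hN : (2 <= N)%N).
Local Notation words := (words hN).

Lemma measurable_fun_coord2 (g : 'I_N -> 'I_N -> R) k l :
  measurable_fun setT (fun x : words => g (x k) (x l)).
Proof.
have -> : (fun x : words => g (x k) (x l)) = (fun x : words =>
    \sum_i \sum_j g i j * (\1_[set y : words | y k = i] x *
                           \1_[set y : words | y l = j] x)).
  apply/funext => x; rewrite (bigD1 (x k))//= (bigD1 (x l))//= !indicE !mem_set//.
  rewrite !mulr1 big1 ?addr0 => [|j /eqP jx].
    rewrite big1 ?addr0// => i /eqP ix; rewrite big1// => j _.
    by rewrite indicE memNset ?mul0r ?mulr0// => /= e; exact/ix.
  by rewrite !indicE (memNset (_ : ~ _)) ?mulr0// => /= e; exact/jx.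
apply: measurable_sum => i; apply: measurable_sum => j.
apply: measurable_funM => //.
by apply: measurable_funM; apply: measurable_indic; exact: measurable_coord.
Qed.

Variables (lambda : 'rV[R]_N) (T : nat -> 'M[R]_N).
Variable mu : probability words R.
Hypothesis data : markov_data lambda T.
Hypothesis muP : markov_measure lambda T mu.
Hypothesis qsT : quasi_stationary hN T.

Let l0 i : 0 < lambda 0 i. Proof. by case: data => -[]. Qed.
Let T0 n i j : 0 < T n i j. Proof. by case: data. Qed.
Let T1 n i : \sum_j T n i j = 1. Proof. by case: data. Qed.

(** This is f_j^2 with the infinite product cut after [n] factors; it depends on the first n + 2
    letters only. *)
Definition partial_density (j : 'I_N) (n : nat) (x : words) : R :=
  (j == x 0%N)%:R *
  (lambda 0 (x 1%N) / (lambda 0 (x 0%N) * T 0%N (x 0%N) (x 1%N)) *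
    \prod_(k < n) ratio T (word_shift x) k).

Lemma partial_density_ge0 j n x : 0 <= partial_density j n x.
Proof.
rewrite mulr_ge0// mulr_ge0//; first by rewrite ltW// divr_gt0// mulr_gt0.
by apply: prodr_ge0 => k _; rewrite ltW// ratio_gt0.
Qed.

Lemma measurable_ratio k : measurable_fun setT (fun x : words => ratio T x k).
Proof.
exact: (measurable_fun_coord2 (fun a b => T k a b / T k.+1 a b)).
Qed.

Lemma measurable_partial_density j n :
  measurable_fun setT (partial_density j n).
Proof.
apply: measurable_funM.
  exact: (measurable_fun_coord2 (fun a _ => (j == a)%:R) 0 0).
apply: measurable_funM.
  exact: (measurable_fun_coord2
    (fun a b => lambda 0 b / (lambda 0 a * T 0%N a b)) 0 1).
apply: measurable_prod => k _.
apply: (measurableT_comp (measurable_ratio k)).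
exact: measurable_word_shift.
Qed.

Lemma markov_F_gt0 (x : words) : 0 < markov_F T x.
Proof.
have [m [M [m0 _ mP cP]]] := ratio_prod_bounded T1 T0 qsT.
apply: lt_le_trans m0 _; apply: limr_ge; first exact: cP.
by apply: nearW => n; have /andP[] := mP x n.
Qed.

Lemma markov_f_sqr j (x : words) : markov_f lambda T j x ^+ 2 =
  (j == x 0%N)%:R *
  (lambda 0 (x 1%N) / (lambda 0 (x 0%N) * T 0%N (x 0%N) (x 1%N)) *
    markov_F T (word_shift x)).
Proof.
rewrite exprMn sqr_sqrtr; first by case: eqP; rewrite ?expr1n ?expr0n.
by rewrite mulr_ge0// ltW ?markov_F_gt0// divr_gt0// mulr_gt0.
Qed.

Lemma markov_f_ge0 j (x : words) : 0 <= markov_f lambda T j x.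
Proof. by rewrite mulr_ge0// sqrtr_ge0. Qed.

Lemma markov_f_gt0 (x : words) : 0 < markov_f lambda T (x 0%N) x.
Proof.
rewrite /markov_f eqxx mul1r sqrtr_gt0 mulr_gt0 ?markov_F_gt0//.
by rewrite divr_gt0// mulr_gt0.
Qed.

Lemma markov_f_neq j (x : words) : j != x 0%N -> markov_f lambda T j x = 0.
Proof. by rewrite /markov_f => /negbTE ->; rewrite mul0r. Qed.

Lemma partial_density_cvg j x :
  partial_density j n x @[n --> \oo] --> markov_f lambda T j x ^+ 2.
Proof.
have [m [M [m0 _ mP cP]]] := ratio_prod_bounded T1 T0 qsT.
rewrite markov_f_sqr.
exact: cvgM (cvg_cst _) (cvgM (cvg_cst _) (cP (word_shift x))).
Qed.

Lemma measurable_markov_f2 j :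
  measurable_fun setT (fun x : words => markov_f lambda T j x ^+ 2).
Proof.
apply: (measurable_fun_cvg (measurable_partial_density j)) => x _.
exact: partial_density_cvg.
Qed.

(** This provides the constant that dominates the truncated densities when [n] tends to infinity. *)
Lemma partial_density_bounded j :
  exists K, forall n x, partial_density j n x <= K.
Proof.
have [m [M [m0 M0 mP cP]]] := ratio_prod_bounded T1 T0 qsT.
pose L a b := lambda 0 b / (lambda 0 a * T 0%N a b).
have L0 a b : 0 <= L a b by rewrite ltW// divr_gt0// mulr_gt0.
exists ((\sum_a \sum_b L a b) * M) => n x.
have P0 : 0 <= \prod_(k < n) ratio T (word_shift x) k.
  by apply: prodr_ge0 => k _; rewrite ltW// ratio_gt0.
rewrite -[leRHS]mul1r; apply: ler_pM; first by [].
- exact: mulr_ge0 (L0 _ _) P0.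
- by case: eqP.
- apply: ler_pM; [exact: L0|by []| |by have /andP[] := mP (word_shift x) n].
  rewrite (bigD1 (x 0%N))//= (bigD1 (x 1%N))//= -addrA lerDl addr_ge0//.
    by apply: sumr_ge0.
  by apply: sumr_ge0 => a _; apply: sumr_ge0.
Qed.

Let nu j n := weighted_image mu (@measurable_word_shift N hN)
  (measurable_partial_density j n) (partial_density_ge0 j n).

(** For [d = 0] the truncated density is constant on the cylinder of the word [j] followed by the
    prefix of [z], and its ratios turn each [T k.+1] in the mass of that cylinder into [T k]. For
    larger [d] the cylinder is split along its next letter. *)
Lemma partial_density_cyl j z n d :
  nu j (n + d) (prefix_cyl z n.+1) = mu (prefix_cyl z n.+1).
Proof.
elim: d n z => [|d IH] n z; last first.
  have mC : measurable (prefix_cyl z n.+1) by exact: measurable_prefix_cyl.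
  rewrite (@measure_coord_split _ _ _ _ _ n.+1)//.
  rewrite [RHS](@measure_coord_split _ _ _ _ _ n.+1)//.
  by apply: eq_bigr => i _; rewrite prefix_cyl_set_letter addnS -addSn IH.
rewrite addn0 (mu_prefix_cyl muP) weighted_imageE integral_mkcond.
pose D := prefix_cyl (wcons j z : words) n.+2.
pose v := lambda 0 (z 0%N) / (lambda 0 j * T 0%N j (z 0%N)) *
  \prod_(k < n) ratio T z k.
have -> : ((fun x => (partial_density j n x)%:E) \_
    (@word_shift N hN @^-1` prefix_cyl z n.+1)) =
    (fun x => (v * \1_D x)%:E).
  apply/funext => x; rewrite patchE indicE.
  have [xz|xz] := boolP (x \in _ @^-1` _); last first.
    rewrite memNset ?mulr0// => xD; move: xz; rewrite notin_setE; apply.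
    by move=> k kn /=; rewrite /word_shift xD.
  move: xz; rewrite inE /= => xz.
  rewrite /partial_density; case: eqP => [jx|jx]; last first.
    rewrite memNset ?mulr0 ?mul0r// => xD; apply: jx.
    by rewrite xD.
  rewrite mem_set ?mul1r ?mulr1; last first.
    by move=> [_|k kn] /=; [rewrite -jx|rewrite -xz].
  have xS k : (k < n.+1)%N -> x k.+1 = z k by move=> kn; exact: xz.
  rewrite /v -jx xS//; congr (_ * _)%:E; apply: eq_bigr => k _.
  by rewrite /ratio /word_shift !xS ?ltnS ?ltn_ord// ltnW.
under eq_integral do rewrite EFinM.
have v0 : 0 <= v.
  rewrite mulr_ge0//; first by rewrite ltW// divr_gt0// mulr_gt0.
  by apply: prodr_ge0 => k _; rewrite ltW// ratio_gt0.
have mD : measurable D by exact: measurable_prefix_cyl.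
rewrite ge0_integralZl//; last exact/measurable_EFinP.
rewrite integral_indic// setIT [X in (_ * X)%E](mu_prefix_cyl muP) -EFinM.
congr (_%:E).
pose P := \prod_(k < n) T k (z k) (z k.+1).
pose Q := \prod_(k < n) T k.+1 (z k) (z k.+1).
have -> : weight lambda T (wcons j z : words) n.+1 =
    lambda 0 j * (T 0%N j (z 0%N) * Q).
  by rewrite /weight big_ord_recl.
rewrite /v /ratio prodf_div /weight -/P -/Q.
have Q0 : Q != 0 by rewrite gt_eqF// prodr_gt0.
by field; rewrite Q0 !gt_eqF.
Qed.

(** * The image of f_j^2 [mu] under the shift is [mu] *)

Definition shift_density j := weighted_image mu (@measurable_word_shift N hN)
  (measurable_markov_f2 j) (fun x => sqr_ge0 _).

(** On a cylinder the images of the truncated densities are eventually equal to [mu], and dominated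
    convergence passes to the limit; cylinders determine the measure. *)
Lemma shift_densityE j A : measurable A -> shift_density j A = mu A.
Proof.
have cyl z n : shift_density j (prefix_cyl z n.+1) = mu (prefix_cyl z n.+1).
  have [K KP] := partial_density_bounded j.
  have mC : measurable (@word_shift N hN @^-1` prefix_cyl z n.+1).
    rewrite -[X in measurable X]setTI; apply: measurable_word_shift => //.
    exact: measurable_prefix_cyl.
  have lim1 : (nu j k (prefix_cyl z n.+1) @[k --> \oo] -->
      shift_density j (prefix_cyl z n.+1))%E.
    apply: (@dominated_cvg _ _ _ mu _ mC _ _ (EFin \o cst K)) => //.
    - move=> k; apply/measurable_EFinP; apply: measurable_funTS.
      exact: measurable_partial_density.
    - move=> x _; apply: cvg_EFin; first exact: nearW.
      exact: partial_density_cvg.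
    - exact: finite_measure_integrable_cst.
    - move=> k x _; rewrite /= lee_fin ger0_norm ?partial_density_ge0//.
  have lim2 : (nu j k (prefix_cyl z n.+1) @[k --> \oo] -->
      mu (prefix_cyl z n.+1))%E.
    apply: cvg_near_cst; exists n => // k /= nk.
    by rewrite -(subnKC nk); exact: partial_density_cyl.
  exact: (cvg_unique _ lim1 lim2).
(* [cyl] covers nonempty prefixes only; the whole space, the cylinder of length 0, is split along
   the first letter. *)
have tot : shift_density j setT = mu setT.
  rewrite (@measure_coord_split _ _ _ _ _ 0)//.
  rewrite [RHS](@measure_coord_split _ _ _ _ _ 0)//.
  apply: eq_bigr => i _.
  by rewrite -(prefix_cyl0 (point : words)) prefix_cyl_set_letter cyl.
apply: measure_unique_prefix_cyl.
  by rewrite [X in (X < _)%E]tot probability_setT ltry.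
by move=> x [|n]; rewrite ?prefix_cyl0.
Qed.

Lemma ge0_integral_shift j (G : words -> \bar R) :
  measurable_fun setT G -> (forall y, 0 <= G y)%E ->
  (\int[mu]_x ((markov_f lambda T j x ^+ 2)%:E * G (word_shift x)) =
   \int[mu]_y G y)%E.
Proof.
by move=> mG G0; exact: (ge0_integral_weighted_image (@shift_densityE j)).
Qed.

Lemma integral_shift j (G : words -> R) :
  measurable_fun setT G ->
  (\int[mu]_x (markov_f lambda T j x ^+ 2 * G (word_shift x))%:E =
   \int[mu]_y (G y)%:E)%E.
Proof. by move=> mG; exact: (integral_weighted_image (@shift_densityE j)). Qed.

(** Being nonnegative, [markov_f] is the power 1/2 of its square, which is a limit of measurable
    truncations. *)
Lemma measurable_markov_f j :
  measurable_fun setT (markov_f lambda T j : words -> R).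
Proof.
have -> : markov_f lambda T j =
    fun x : words => powR (markov_f lambda T j x ^+ 2) 2^-1.
  apply/funext => x; rewrite powR12_sqrt ?sqr_ge0// sqrtr_sqr ger0_norm//.
  exact: markov_f_ge0.
exact: (measurableT_comp (measurable_powR 2^-1) (measurable_markov_f2 j)).
Qed.

(** Where the first letter is [j], [g] is f_j times this function composed with the shift. The inner
    product of [markov_S] applied to [f] with [g] then carries the factor f_j^2, which
    [integral_shift] absorbs. *)
Definition adjoint_S (j : 'I_N) (g : words -> R[i]) (y : words) : R[i] :=
  ((markov_f lambda T j (wcons j y : words))^-1)%:C%C * g (wcons j y).

Lemma markov_S_adjoint_S j g x :
  markov_S lambda T j (adjoint_S j g) x = (j == x 0%N)%:R * g x.
Proof.
rewrite /markov_S /adjoint_S; have [->|jx] := eqVneq j (x 0%N); last first.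
  by rewrite markov_f_neq// !mul0r.
rewrite wcons_word_shift mulrA -rmorphM/= divff ?gt_eqF ?markov_f_gt0//.
Qed.

Lemma measurable_adjoint_S j g (p : R[i] -> R) :
  (forall (a : R) z, p (a%:C%C * z) = a * p z) ->
  measurable_fun setT (p \o g) -> measurable_fun setT (p \o adjoint_S j g).
Proof.
move=> pM mg.
have -> : p \o adjoint_S j g = fun y =>
    powR (markov_f lambda T j (wcons j y : words)) (-1) * (p \o g) (wcons j y).
  by apply/funext => y; rewrite /= /adjoint_S pM powR_inv1// markov_f_ge0.
apply: measurable_funM.
  apply: (measurableT_comp (measurable_powR (-1))).
  exact: (measurableT_comp (measurable_markov_f j) (@measurable_wcons N hN j)).
exact: (measurableT_comp mg (@measurable_wcons N hN j)).
Qed.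

(** Here [p] is meant to be the squared modulus, so that the norm of [adjoint_S j g] becomes an
    integral over the words that start with [j]. *)
Lemma markov_f_sqr_adjoint_S j g x (p : R[i] -> R) :
  (forall (a : R) z, p (a%:C%C * z) = a ^+ 2 * p z) ->
  markov_f lambda T j x ^+ 2 * p (adjoint_S j g (word_shift x)) =
  (j == x 0%N)%:R * p (g x).
Proof.
move=> pM; rewrite -pM -/(markov_S lambda T j (adjoint_S j g) x).
rewrite markov_S_adjoint_S -[X in X * g x](rmorph_nat (real_complex R)) pM.
by case: eqP; rewrite ?expr1n ?expr0n.
Qed.

Lemma is_adjoint_image_S j g : L2fun mu g ->
  is_adjoint_image mu (markov_S lambda T j) g (adjoint_S j g).
Proof.
move=> [mRg mIg g2].
have mRh := measurable_adjoint_S j (@ReCM R) mRg.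
have mIh := measurable_adjoint_S j (@ImCM R) mIg.
split.
  split => //; apply: le_lt_trans g2.
  rewrite /L2sqnorm -(ge0_integral_shift j); last 2 first.
  - apply/measurable_EFinP; apply: measurable_funD;
    by [exact: (measurable_funX 2 mRh)|exact: (measurable_funX 2 mIh)].
  - by move=> y; rewrite lee_fin addr_ge0// sqr_ge0.
  have sqM (a : R) z :
      complex.Re (a%:C%C * z) ^+ 2 + complex.Im (a%:C%C * z) ^+ 2 =
      a ^+ 2 * (complex.Re z ^+ 2 + complex.Im z ^+ 2).
    by rewrite ReCM ImCM !exprMn mulrDr.
  have mg2 : measurable_fun setT
      (fun x => complex.Re (g x) ^+ 2 + complex.Im (g x) ^+ 2).
    exact: measurable_funD (measurable_funX 2 mRg) (measurable_funX 2 mIg).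
  rewrite [leLHS](_ : _ = \int[mu]_x ((j == x 0%N)%:R *
      (complex.Re (g x) ^+ 2 + complex.Im (g x) ^+ 2))%:E)%E; last first.
    apply: eq_integral => x _.
    exact: (congr1 EFin (markov_f_sqr_adjoint_S j g x sqM)).
  apply: ge0_le_integral => //.
  - by move=> x _; rewrite lee_fin mulr_ge0// addr_ge0// sqr_ge0.
  - apply/measurable_EFinP; apply: measurable_funM => //.
    exact: (measurable_fun_coord2 (fun a _ => (j == a)%:R) 0 0).
  - exact/measurable_EFinP.
  - move=> x _; rewrite lee_fin; case: eqP => _; rewrite ?mul1r// mul0r.
    by rewrite addr_ge0// sqr_ge0.
move=> f [mRf mIf _].
have key x : markov_S lambda T j f x * (g x)^*%C =
    (markov_f lambda T j x ^+ 2)%:C%C *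
    (f (word_shift x) * (adjoint_S j g (word_shift x))^*%C).
  rewrite /markov_S; have [->|jx] := eqVneq j (x 0%N); last first.
    by rewrite markov_f_neq// expr0n !mul0r.
  have -> : g x = (markov_f lambda T (x 0%N) x)%:C%C *
      adjoint_S (x 0%N) g (word_shift x).
    by have := markov_S_adjoint_S (x 0%N) g x; rewrite eqxx mul1r.
  rewrite conjCM rmorphXn/= expr2 -!mulrA; congr (_ * _); exact: mulrCA.
rewrite /L2_inner /Rintegral; congr (fine _ +i* fine _)%C.
  under eq_integral do rewrite key ReCM.
  apply: (@integral_shift j (fun y => complex.Re (f y * (adjoint_S j g y)^*%C))).
  have -> : (fun y => complex.Re (f y * (adjoint_S j g y)^*%C)) = fun y =>
      complex.Re (f y) * complex.Re (adjoint_S j g y) +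
      complex.Im (f y) * complex.Im (adjoint_S j g y).
    by apply/funext => y; case: (f y) => a b; case: (adjoint_S j g y) => u v /=;
      rewrite mulrN opprK.
  by apply: measurable_funD; exact: measurable_funM.
under eq_integral do rewrite key ImCM.
apply: (@integral_shift j (fun y => complex.Im (f y * (adjoint_S j g y)^*%C))).
have -> : (fun y => complex.Im (f y * (adjoint_S j g y)^*%C)) = fun y =>
    complex.Im (f y) * complex.Re (adjoint_S j g y) -
    complex.Re (f y) * complex.Im (adjoint_S j g y).
  by apply/funext => y; case: (f y) => a b; case: (adjoint_S j g y) => u v /=;
    rewrite mulrN addrC.
by apply: measurable_funB; exact: measurable_funM.
Qed.

End ShiftDensity.

(** * Closed subspaces of L^2 *)

Section ClosedSubspace.
Context d (X : measurableType d) (R : realType).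
Variable mu : {measure set X -> \bar R}.
Implicit Types (f g h : X -> R[i]) (A B : set X) (w : X -> R).

Local Notation Re := (@complex.Re R).
Local Notation Im := (@complex.Im R).

Definition sqnormc (z : R[i]) : R := Re z ^+ 2 + Im z ^+ 2.

Lemma sqnormc_ge0 z : 0 <= sqnormc z.
Proof. by rewrite addr_ge0// sqr_ge0. Qed.

Lemma sqnormc_eq0 z : (sqnormc z == 0) = (z == 0).
Proof. by rewrite paddr_eq0 ?sqr_ge0// !sqrf_eq0 [RHS]eq_complex. Qed.

Lemma sqnormcM z1 z2 : sqnormc (z1 * z2) = sqnormc z1 * sqnormc z2.
Proof. by case: z1 z2 => a b [u v]; rewrite /sqnormc /=; ring. Qed.

Lemma sqnormcB z1 z2 : sqnormc (z1 - z2) <= 2 * (sqnormc z1 + sqnormc z2).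
Proof.
case: z1 z2 => a b [u v]; rewrite /sqnormc /=.
have := sqr_ge0 (a + u); have := sqr_ge0 (b + v); nra.
Qed.

Lemma sqnormc_real (a : R) : sqnormc (a%:C%C) = a ^+ 2.
Proof. by rewrite /sqnormc /= expr0n addr0. Qed.

Lemma measurable_sqnormc f : measurable_fun setT (Re \o f) ->
  measurable_fun setT (Im \o f) -> measurable_fun setT (sqnormc \o f).
Proof.
move=> mR mI; apply: measurable_funD.
  exact: (measurable_funX 2 mR).
exact: (measurable_funX 2 mI).
Qed.

Lemma L2fun_integrable f : L2fun mu f ->
  mu.-integrable setT (EFin \o (sqnormc \o f)).
Proof.
move=> [mR mI f2]; apply/integrableP; split.
  by apply/measurable_EFinP; exact: measurable_sqnormc.
under eq_integral do rewrite /= ger0_norm ?sqnormc_ge0//.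
exact: f2.
Qed.

Lemma L2fun_le f h : measurable_fun setT (Re \o f) ->
  measurable_fun setT (Im \o f) -> L2fun mu h ->
  (forall x, sqnormc (f x) <= sqnormc (h x)) -> L2fun mu f.
Proof.
move=> mR mI [hR hI h2] fh; split => //; apply: le_lt_trans h2.
apply: ge0_le_integral => //.
- by move=> x _; rewrite lee_fin sqnormc_ge0.
- by apply/measurable_EFinP; exact: measurable_sqnormc.
- by apply/measurable_EFinP; exact: measurable_sqnormc.
- by move=> x _; rewrite lee_fin; exact: fh.
Qed.

Lemma measurable_patch0 w A : measurable A -> measurable_fun setT w ->
  measurable_fun setT (w \_ A).
Proof.
move=> mA mw; apply/(measurable_restrictT _ mA).
exact: measurable_funTS.
Qed.

Definition cut A f : X -> R[i] := fun x => if x \in A then f x else 0.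

Lemma L2fun_cut f A : measurable A -> L2fun mu f -> L2fun mu (cut A f).
Proof.
move=> mA Lf; have [mR mI _] := Lf.
have E (p : R[i] -> R) : p 0 = 0 -> p \o cut A f = (p \o f) \_ A.
  by move=> p0; apply/funext => x; rewrite /= patchE /cut; case: ifP.
apply: (L2fun_le _ _ Lf).
- by rewrite E//; exact: measurable_patch0.
- by rewrite E//; exact: measurable_patch0.
- move=> x; rewrite /cut; case: ifP => // _.
  by rewrite (_ : sqnormc 0 = 0) ?sqnormc_ge0//; apply/eqP; rewrite sqnormc_eq0.
Qed.

Lemma L2fun_realM w g h : measurable_fun setT w -> L2fun mu g -> L2fun mu h ->
  (forall x, w x ^+ 2 * sqnormc (g x) <= sqnormc (h x)) ->
  L2fun mu (fun x => (w x)%:C%C * g x).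
Proof.
move=> mw [mR mI _] Lh wgh; apply: L2fun_le Lh _.
- rewrite (_ : _ \o _ = fun x => w x * Re (g x)); first exact: measurable_funM.
  by apply/funext => x /=; case: (g x) => a b /=; rewrite mul0r subr0.
- rewrite (_ : _ \o _ = fun x => w x * Im (g x)); first exact: measurable_funM.
  by apply/funext => x /=; case: (g x) => a b /=; rewrite mul0r addr0.
- by move=> x; rewrite sqnormcM sqnormc_real.
Qed.

(** * Closed subspaces and pointwise limits *)

Variable V : set (X -> R[i]).
Hypothesis cV : closed_subspace mu V.

Lemma closed_subspaceD f g : V f -> V g -> V (fun x => f x + g x).
Proof.
have [_ _ lV _] := cV; move=> Vf Vg.
by have := lV 1 f g Vf Vg; under eq_fun do rewrite mul1r.
Qed.

Lemma closed_subspaceZ (a : R[i]) f : V f -> V (fun x => a * f x).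
Proof.
have [_ V0 lV _] := cV; move=> Vf.
by have := lV a f _ Vf V0; under eq_fun do rewrite addr0.
Qed.

Lemma closed_subspace_sum I (s : seq I) (u : I -> X -> R[i]) :
  (forall i, V (u i)) -> V (fun x => \sum_(i <- s) u i x).
Proof.
move=> Vu; elim: s => [|i s IH].
  by under eq_fun do rewrite big_nil; case: cV.
by under eq_fun do rewrite big_cons; exact: closed_subspaceD.
Qed.

(** The squared distance of [u n x] to [f x] is at most twice the sum of the squared moduli of [h x]
    and [f x], which is integrable; dominated convergence gives the limit in L^2. *)
Lemma closed_subspace_dominated (u : nat -> X -> R[i]) f h :
  (forall n, V (u n)) -> L2fun mu f -> L2fun mu h ->
  (forall n x, sqnormc (u n x) <= sqnormc (h x)) ->
  (forall x, Re (u n x) @[n --> \oo] --> Re (f x)) ->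
  (forall x, Im (u n x) @[n --> \oo] --> Im (f x)) -> V f.
Proof.
move=> Vu Lf Lh uh uR uI; have [VL _ _ clV] := cV; apply: (clV _ _ Vu Lf).
pose e n x := (sqnormc (u n x - f x))%:E.
have <- : (\int[mu]_x (cst 0%E : X -> \bar R) x = 0)%E by exact: integral0.
have mL g1 : L2fun mu g1 ->
    measurable_fun setT (Re \o g1) /\ measurable_fun setT (Im \o g1).
  by case.
apply: (@dominated_cvg _ _ _ mu setT measurableT e _
  (fun x => (2 * (sqnormc (h x) + sqnormc (f x)))%:E)) => //.
- move=> n; apply/measurable_EFinP.
  apply: (@measurable_sqnormc (fun x => u n x - f x)).
    rewrite (_ : _ \o _ = (Re \o u n) \- (Re \o f)); last first.
      by apply/funext => x /=; case: (u n x) => ? ?; case: (f x).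
    by apply: measurable_funB; [have [] := mL _ (VL _ (Vu n))|have [] := mL _ Lf].
  rewrite (_ : _ \o _ = (Im \o u n) \- (Im \o f)); last first.
    by apply/funext => x /=; case: (u n x) => ? ?; case: (f x).
  by apply: measurable_funB; [have [] := mL _ (VL _ (Vu n))|have [] := mL _ Lf].
- move=> x _; apply: cvg_EFin; first exact: nearW.
  have -> : (0 : R) = (Re (f x) - Re (f x)) * (Re (f x) - Re (f x)) +
      (Im (f x) - Im (f x)) * (Im (f x) - Im (f x)).
    by rewrite !subrr mulr0 addr0.
  rewrite (_ : fine \o _ = fun n =>
    (Re (u n x) - Re (f x)) * (Re (u n x) - Re (f x)) +
    (Im (u n x) - Im (f x)) * (Im (u n x) - Im (f x))); last first.
    by apply/funext => n /=; rewrite /sqnormc; case: (u n x) => ? ?; case: (f x).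
  by apply: cvgD; apply: cvgM; apply: cvgB => //; exact: cvg_cst.
- under eq_fun do rewrite EFinM.
  apply: integrableZl => //.
  exact: (integrableD measurableT (L2fun_integrable Lh) (L2fun_integrable Lf)).
- move=> n x _; rewrite /e /= lee_fin ger0_norm ?sqnormc_ge0//.
  by apply: le_trans (sqnormcB _ _) _; rewrite ler_pM2l// lerD2r.
Qed.

Lemma closed_subspace_ae f g : V f -> L2fun mu g ->
  {ae mu, forall x, f x = g x} -> V g.
Proof.
move=> Vf Lg fg; have [VL _ _ clV] := cV.
apply: (clV (fun=> f)) => //.
rewrite (_ : (fun n : nat => _) = cst 0%E); first exact: cvg_cst.
apply/funext => n; rewrite /L2sqnorm /=.
have [fR fI _] := VL _ Vf; have [gR gI _] := Lg.
rewrite -(@integral0 _ _ _ mu setT); apply: ae_eq_integral => //.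
- apply/measurable_EFinP; apply: (@measurable_sqnormc (fun x => f x - g x)).
    rewrite (_ : _ \o _ = (Re \o f) \- (Re \o g)); first exact: measurable_funB.
    by apply/funext => x /=; case: (f x) => ? ?; case: (g x).
  rewrite (_ : _ \o _ = (Im \o f) \- (Im \o g)); first exact: measurable_funB.
  by apply/funext => x /=; case: (f x) => ? ?; case: (g x).
- by apply: filterS fg => x -> _; rewrite subrr /= expr0n addr0.
Qed.

Lemma closed_subspace_cut_bigcup (F : nat -> set X) g :
  (forall k, measurable (F k)) -> L2fun mu g ->
  (forall n, V (cut (\bigcup_(k < n) F k) g)) -> V (cut (\bigcup_k F k) g).
Proof.
move=> mF Lg VF.
have mU : measurable (\bigcup_k F k) by exact: bigcupT_measurable.
have near_eq x : \forall n \near \oo,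
    cut (\bigcup_(k < n) F k) g x = cut (\bigcup_k F k) g x.
  have [[k _ Fk]|nF] := pselect ((\bigcup_k F k) x).
    by exists k.+1 => // n /= kn; rewrite /cut !mem_set//; exists k.
  apply: nearW => n; rewrite /cut !memNset// => -[k _ Fk].
  by apply: nF; exists k.
apply: (closed_subspace_dominated VF _ Lg).
- exact: L2fun_cut.
- move=> n x; rewrite /cut; case: ifP => // _.
  by rewrite (_ : sqnormc 0 = 0) ?sqnormc_ge0//; apply/eqP; rewrite sqnormc_eq0.
- move=> x; apply: cvg_near_cst; near=> n; congr Re; near: n; exact: near_eq.
- move=> x; apply: cvg_near_cst; near=> n; congr Im; near: n; exact: near_eq.
Unshelve. all: by end_near. Qed.

(** The sets whose indicators multiply [V] into itself form a sigma-algebra: complements come from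
    subtraction, intersections from composition, and countable unions from finite ones because [V]
    is closed. *)
Lemma closed_subspace_cut (G : set (set X)) :
  (measurable : set (set X)) = <<s G >> ->
  (forall A g, G A -> V g -> V (cut A g)) ->
  forall A g, measurable A -> V g -> V (cut A g).
Proof.
move=> mG VG; have [VL V0 lV clV] := cV.
pose H : set (set X) := [set A | measurable A /\ forall g, V g -> V (cut A g)].
suff HM : measurable `<=` H by move=> A g /HM[_]; apply.
have HC A : H A -> H (~` A).
  move=> [mA VA]; split => [|g Vg]; first exact: measurableC.
  have := lV (-1) _ _ (VA _ Vg) Vg; congr V; apply/funext => x.
  rewrite /cut in_setC; case: (x \in A) => /=; last by rewrite mulr0 add0r.
  by rewrite mulN1r addNr.
have HI A B : H A -> H B -> H (A `&` B).
  move=> [mA VA] [mB VB]; split => [|g Vg]; first exact: measurableI.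
  have := VB _ (VA _ Vg); congr V; apply/funext => x; rewrite /cut in_setI.
  by case: (x \in A); case: (x \in B).
rewrite mG; apply: smallest_sub; last first.
  move=> A GA; split; last by move=> g; exact: VG.
  by rewrite mG; exact: sub_sigma_algebra.
have H0 : H set0.
  split => // g _; rewrite (_ : cut set0 g = fun=> 0)//.
  by apply/funext => x; rewrite /cut in_set0.
split; [exact: H0|by move=> A; rewrite setTD; exact: HC|].
move=> F HF; have mF k : measurable (F k) by have [] := HF k.
split=> [|g Vg]; first exact: bigcupT_measurable.
have HU n : H (\bigcup_(k < n) F k).
  elim: n => [|n IH]; first by rewrite bigcup_mkord big_ord0.
  rewrite bigcup_mkord big_ord_recr/= -bigcup_mkord -[X in H X]setCK setCU.
  exact: HC (HI _ _ (HC _ IH) (HC _ (HF n))).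
by apply: closed_subspace_cut_bigcup => //; [exact: VL|move=> n; exact: (HU n).2].
Qed.

(** * Subspaces stable under multiplication by indicators *)

Hypothesis cutV : forall A g, measurable A -> V g -> V (cut A g).

Import HBNNSimple.

(** Simple functions increase to [w]; each of them times [g] is a linear combination of cuts of [g],
    dominated by [w] times [g]. *)
Lemma closed_subspace_ge0M w g :
  measurable_fun setT w -> (forall x, 0 <= w x) ->
  V g -> L2fun mu (fun x => (w x)%:C%C * g x) -> V (fun x => (w x)%:C%C * g x).
Proof.
move=> mw w0 Vg Lwg.
have mEw : measurable_fun setT (EFin \o w) by exact/measurable_EFinP.
pose w_ := nnsfun_approx measurableT mEw.
have wE0 x : [set: X] x -> (0 <= (EFin \o w) x)%E by move=> _; rewrite lee_fin.
have w_cvg x : w_ n x @[n --> \oo] --> w x.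
  have /fine_cvgP[_] := cvg_nnsfun_approx measurableT mEw wE0 (I : [set: X] x).
  exact.
have w_le n x : w_ n x <= w x.
  have ndw : nondecreasing_seq (w_ ^~ x).
    by move=> a b ab; have /lefP := nd_nnsfun_approx measurableT mEw ab; exact.
  by rewrite -(cvg_lim _ (w_cvg x))//; apply: nondecreasing_cvgn_le => //;
    apply/cvg_ex; exists (w x).
apply: (@closed_subspace_dominated (fun n x => (w_ n x)%:C%C * g x) _ _ _ Lwg Lwg).
- move=> n.
  have -> : (fun x => (w_ n x)%:C%C * g x) = fun x =>
      \sum_(r <- fset_set (range (w_ n)))
        r%:C%C * cut (w_ n @^-1` [set r]) g x.
    apply/funext => x; rewrite fimfunE fsbig_finite//= rmorph_sum mulr_suml.
    apply: eq_bigr => r _; rewrite /= indicE rmorphM/= rmorph_nat -mulrA /cut.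
    by case: (x \in _); rewrite ?mul1r ?mul0r.
  apply: closed_subspace_sum => r; apply: closed_subspaceZ.
  by apply: cutV.
- move=> n x; rewrite !sqnormcM !sqnormc_real ler_wpM2r ?sqnormc_ge0//.
  by rewrite ler_sqr ?nnegrE.
- move=> x; under eq_fun do rewrite ReCM.
  by rewrite ReCM; exact: cvgM (w_cvg x) (cvg_cst _).
- move=> x; under eq_fun do rewrite ImCM.
  by rewrite ImCM; exact: cvgM (w_cvg x) (cvg_cst _).
Qed.


(** The function [f] is a measurable multiple of [g]. The real and imaginary parts of the multiplier
    are split into positive and negative parts, to which [closed_subspace_ge0M] applies. *)
Lemma closed_subspaceM f g :
  V g -> L2fun mu f -> (forall x, g x = 0 -> f x = 0) -> V f.
Proof.
move=> Vg Lf gf; have [VL _ lV _] := cV.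
have [fR fI _] := Lf; have [gR gI _] := VL _ Vg.
pose q x := powR (sqnormc (g x)) (-1).
have mq : measurable_fun setT q.
  exact: (measurableT_comp (measurable_powR (-1)) (measurable_sqnormc gR gI)).
(* [a] and [b] are the real and imaginary parts of [f] times the conjugate of [g], divided by the
   squared modulus of [g]. Where [g] vanishes their values do not matter, since [f] vanishes too. *)
pose a x := (Re (f x) * Re (g x) + Im (f x) * Im (g x)) * q x.
pose b x := (Im (f x) * Re (g x) - Re (f x) * Im (g x)) * q x.
have ma : measurable_fun setT a.
  by apply: measurable_funM => //; apply: measurable_funD; exact: measurable_funM.
have mb : measurable_fun setT b.
  by apply: measurable_funM => //; apply: measurable_funB; exact: measurable_funM.
have fE x : f x = (a x +i* b x)%C * g x.
  have [g0|g0] := eqVneq (g x) 0; first by rewrite gf// g0 mulr0.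
  have {g0} : sqnormc (g x) != 0 by rewrite sqnormc_eq0.
  rewrite /a /b /q powR_inv1 ?sqnormc_ge0// /sqnormc.
  case: (f x) (g x) => u v [u' v'] /= n0.
  by apply/eqP; rewrite eq_complex /=; apply/andP; split; apply/eqP; field.
(* The last condition says that [w] times [g] is dominated by [f], hence square-integrable. *)
have VM w : measurable_fun setT w -> (forall x, 0 <= w x) ->
    (forall x, w x ^+ 2 <= a x ^+ 2 + b x ^+ 2) -> V (fun x => (w x)%:C%C * g x).
  move=> mw w0 wab; apply: closed_subspace_ge0M => //.
  apply: (L2fun_realM mw (VL _ Vg) Lf) => x.
  by rewrite [in leRHS]fE sqnormcM ler_wpM2r ?sqnormc_ge0.
have VMs (s : X -> R) : measurable_fun setT s ->
    (forall x, s x ^+ 2 <= a x ^+ 2 + b x ^+ 2) -> V (fun x => (s x)%:C%C * g x).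
  move=> ms sab.
  have Vp : V (fun x => (Num.max (s x) 0)%:C%C * g x).
    apply: VM => [|x|x]; first exact: measurable_maxr.
      by rewrite le_max lexx orbT.
    by apply: le_trans (sab x); case: (leP (s x) 0) => _ //; rewrite expr0n sqr_ge0.
  have Vn : V (fun x => (Num.max (- s x) 0)%:C%C * g x).
    apply: VM => [|x|x].
    - by apply: measurable_maxr => //; exact: measurableT_comp.
    - by rewrite le_max lexx orbT.
    by apply: le_trans (sab x); case: (leP (- s x) 0) => _;
      rewrite ?sqrrN// expr0n sqr_ge0.
  have := lV (-1) _ _ Vn Vp; congr V; apply/funext => x.
  rewrite mulrA -mulrDl; congr (_ * _); rewrite mulN1r addrC -rmorphB/=.
  congr (_%:C)%C; case: (leP (s x) 0) => s0.
    by rewrite max_l ?oppr_ge0// sub0r opprK.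
  by rewrite max_r ?oppr_le0 ?ltW// subr0.
have := lV ('i)%C _ _ (VMs b mb _) (VMs a ma _); rewrite (_ : (fun x => _) = f).
  by apply => x; rewrite ?lerDl ?lerDr sqr_ge0.
apply/funext => x; rewrite [RHS]fE mulrA -mulrDl; congr (_ * _).
by apply/eqP; rewrite eq_complex /=; apply/andP; split; apply/eqP; ring.
Qed.

End ClosedSubspace.

(** * Irreducibility *)

Section Irreducible.
Context (R : realType) (N : nat) (hN : (2 <= N)%N).
Local Notation words := (words hN).
Variables (lambda : 'rV[R]_N) (T : nat -> 'M[R]_N).
Variable mu : probability words R.
Hypothesis data : markov_data lambda T.
Hypothesis muP : markov_measure lambda T mu.
Hypothesis qsT : quasi_stationary hN T.
Local Notation S := (markov_S lambda T).
Local Notation adj := (adjoint_S lambda T).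
Local Notation shift := (@word_shift N hN).

Variable V : set (words -> R[i]).
Hypothesis cV : closed_subspace mu V.
Hypothesis VS : forall i f, V f -> V (S i f).
Hypothesis VSadj : forall i g h, V g -> is_adjoint_image mu (S i) g h -> V h.

Let VL g : V g -> L2fun mu g. Proof. by case: cV => + _ _ _; exact. Qed.

Lemma invariant_adjoint_S i g : V g -> V (adj i g).
Proof.
move=> Vg; apply: (VSadj Vg); apply: (is_adjoint_image_S data muP qsT).
exact: VL.
Qed.

(* [S_I S_I^*] is the multiplication by the indicator of the cylinder of [I]. *)
Lemma invariant_cut_prefix_cyl (x : words) n g :
  V g -> V (cut (prefix_cyl x n) g).
Proof.
elim: n x g => [|n IH] x g Vg.
  rewrite prefix_cyl0 (_ : cut _ _ = g)//.
  by apply/funext => y; rewrite /cut in_setT.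
have := VS (x 0%N) (IH (shift x) _ (invariant_adjoint_S (x 0%N) Vg)).
congr V; apply/funext => y; rewrite /markov_S /cut.
have [yx|yx] := boolP (shift y \in _); last first.
  rewrite mulr0 memNset// => xy; move: yx; rewrite notin_setE; apply => k kn.
  by rewrite /word_shift xy.
rewrite -/(markov_S lambda T (x 0%N) (adj (x 0%N) g) y) markov_S_adjoint_S//.
move: yx; rewrite inE => yx; have [xy0|xy0] := eqVneq (x 0%N) (y 0%N).
  by rewrite mul1r mem_set// => -[_|k kn]//; exact: yx.
rewrite mul0r memNset// => xy; move/eqP: xy0; apply.
by rewrite xy.
Qed.

Lemma invariant_cut A g : measurable A -> V g -> V (cut A g).
Proof.
move=> mA Vg; apply: (closed_subspace_cut cV (@measurable_prefix_cyls N hN)) => //.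
move=> _ h [->|[x [n ->]]] Vh; last exact: invariant_cut_prefix_cyl.
have -> : cut set0 h = fun=> 0 by apply/funext => x; rewrite /cut in_set0.
by case: cV.
Qed.

(** * Sets whose indicator belongs to the invariant subspace *)

Lemma L2fun_cst1 : L2fun mu (cst 1 : words -> R[i]).
Proof.
split; [exact: measurable_cst|exact: measurable_cst|].
rewrite /L2sqnorm /= expr1n expr0n addr0 integral_cst// mul1e.
by rewrite [X in (X < _)%E]probability_setT ltry.
Qed.

(** By [closed_subspaceM], once this indicator is in [V], so is every square-integrable function
    that vanishes outside [A]. *)
Definition filled (A : set words) : Prop := V (cut A (cst 1)).

Lemma filled_nonzero A g : measurable A -> V g -> (forall x, A x -> g x != 0) ->
  filled A.
Proof.
move=> mA Vg Ag; apply: (closed_subspaceM cV invariant_cut Vg).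
  by apply: L2fun_cut => //; exact: L2fun_cst1.
move=> x gx; rewrite /cut memNset// => /Ag.
by rewrite gx eqxx.
Qed.

Lemma cut1_neq0 A x : A x -> cut A (cst 1 : words -> R[i]) x != 0.
Proof. by move=> Ax; rewrite /cut mem_set// oner_eq0. Qed.

Lemma cut1_ge0 A x : 0 <= cut A (cst 1 : words -> R[i]) x.
Proof. by rewrite /cut; case: ifP. Qed.

Lemma filled_setU A B : measurable A -> measurable B -> filled A -> filled B ->
  filled (A `|` B).
Proof.
move=> mA mB fA fB; apply: (filled_nonzero _ (closed_subspaceD cV fA fB)).
  exact: measurableU.
move=> x ABx; rewrite paddr_eq0 ?cut1_ge0// negb_and.
by case: ABx => /cut1_neq0 ->; rewrite ?orbT.
Qed.

Lemma filled_bigcup (F : nat -> set words) :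
  (forall k, measurable (F k)) -> (forall k, filled (F k)) ->
  filled (\bigcup_k F k).
Proof.
move=> mF fF; apply: (closed_subspace_cut_bigcup cV) => //; first exact: L2fun_cst1.
elim=> [|n IH].
  rewrite bigcup_mkord big_ord0 (_ : cut _ _ = fun=> 0); first by case: cV.
  by apply/funext => x; rewrite /cut in_set0.
rewrite bigcup_mkord big_ord_recr/= -bigcup_mkord; apply: filled_setU => //.
by apply: bigcup_measurable.
Qed.

Lemma measurable_shift_preimage A : measurable A -> measurable (shift @^-1` A).
Proof.
move=> mA; rewrite -[X in measurable X]setTI; exact: measurable_word_shift.
Qed.

(** Images of measurable sets need not be measurable in general; this finite union of preimages
    shows that those under the shift are. *)
Lemma shift_imageE A : shift @` A = \big[setU/set0]_(j < N) (wcons j @^-1` A).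
Proof.
rewrite -bigcup_seq; apply/seteqP; split => [_ [x Ax <-]|y [j _ Ay]].
  exists (x 0%N); first by rewrite /= mem_index_enum.
  by rewrite /= wcons_word_shift.
by exists (wcons j y).
Qed.

Lemma measurable_wcons_preimage A (j : 'I_N) : measurable A ->
  measurable (wcons j @^-1` A : set words).
Proof.
move=> mA; rewrite -[X in measurable X]setTI; exact: measurable_wcons.
Qed.

Lemma measurable_shift_image A : measurable A -> measurable (shift @` A).
Proof.
move=> mA; rewrite shift_imageE; apply: bigsetU_measurable => j _.
exact: measurable_wcons_preimage.
Qed.

(** The sum over [j] of [markov_S] applied to the indicator of [A] does not vanish on the preimage:
    at [x] only the term of the first letter of [x] remains, and its factor [markov_f] is
    positive. *)
Lemma filled_shift_preimage A : measurable A -> filled A ->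
  filled (shift @^-1` A).
Proof.
move=> mA fA; apply: (@filled_nonzero _
  (fun x => \sum_(j < N) S j (cut A (cst 1)) x)).
- exact: measurable_shift_preimage.
- by apply: (closed_subspace_sum cV) => j; exact: VS.
- move=> x Ax; rewrite (bigD1 (x 0%N))//= big1 ?addr0 => [|j jx].
    rewrite mulf_neq0 ?cut1_neq0//.
    by rewrite eq_complex /= eqxx andbT gt_eqF// markov_f_gt0.
  by rewrite /markov_S markov_f_neq// mul0r.
Qed.

Lemma filled_shift_image A : measurable A -> filled A -> filled (shift @` A).
Proof.
move=> mA fA; rewrite shift_imageE.
(* Measurability is carried through the induction because [filled_setU] asks for it. *)
have [] : measurable (\big[setU/set0]_(j < N) (wcons j @^-1` A : set words)) /\
    filled (\big[setU/set0]_(j < N) (wcons j @^-1` A)); last by [].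
apply: (big_ind (fun B => measurable B /\ filled B)).
- split => //; rewrite /filled (_ : cut _ _ = fun=> 0); first by case: cV.
  by apply/funext => x; rewrite /cut in_set0.
- by move=> B C [mB fB] [mC fC]; split; [exact: measurableU|exact: filled_setU].
- move=> j _; split; first exact: measurable_wcons_preimage.
  apply: (filled_nonzero _ (invariant_adjoint_S j fA)).
    exact: measurable_wcons_preimage.
  move=> x Ax; rewrite mulf_neq0 ?cut1_neq0//.
  rewrite eq_complex /= eqxx andbT invr_eq0 gt_eqF//.
  by have := markov_f_gt0 data qsT (wcons j x : words).
Qed.

(* The union of the sets s^-m (s^n A) is the smallest set containing A that
   equals its preimage under s. *)
Lemma filled_saturation A : measurable A -> filled A -> exists B,
  [/\ measurable B, filled B, A `<=` B & shift @^-1` B = B].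
Proof.
move=> mA fA; pose F n := iter n (fun B => shift @` B) A.
have F_ n : measurable (F n) /\ filled (F n).
  elim: n => [//|n [mF fF]]; rewrite /F iterS.
  by split; [exact: measurable_shift_image|exact: filled_shift_image].
pose D := \bigcup_n F n.
have mD : measurable D by apply: bigcupT_measurable => n; have [] := F_ n.
have fD : filled D by apply: filled_bigcup => n; have [] := F_ n.
(* This settles the case [m = 0] when the union of the [G m] is shown to be contained in its
   preimage. *)
have Dsub : D `<=` shift @^-1` D.
  by move=> x [n _ Fx]; exists n.+1 => //; rewrite /F iterS; exists x.
pose G m := iter m (fun B => shift @^-1` B) D.
have G_ m : measurable (G m) /\ filled (G m).
  elim: m => [//|m [mG fG]]; rewrite /G iterS.
  by split; [exact: measurable_shift_preimage|exact: filled_shift_preimage].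
exists (\bigcup_m G m); split.
- by apply: bigcupT_measurable => m; have [] := G_ m.
- by apply: filled_bigcup => m; have [] := G_ m.
- by move=> x Ax; exists 0%N => //; exists 0%N.
- apply/seteqP; split => [x [m _ Gx]|x [[|m] _ Gx]].
  + by exists m.+1.
  + by exists 0%N => //; exact: Dsub.
  + by exists m.
Qed.

End Irreducible.

Lemma markov_irreducible (R : realType) (N : nat) (hN : (2 <= N)%N)
    (lambda : 'rV[R]_N) (T : nat -> 'M[R]_N) (mu : probability (words hN) R) :
  markov_data lambda T -> markov_measure lambda T mu -> quasi_stationary hN T ->
  ergodic mu (@word_shift N hN) ->
  irreducible_family mu (@markov_S R N hN lambda T).
Proof.
move=> data muP qsT erg V cV VS VSadj; have [VL V0 lV _] := cV.
have [ae0|] := pselect (forall g, V g -> {ae mu, forall x, g x = 0}).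
  left; apply/seteqP; split => g.
    by move=> Vg; split; [exact: VL|exact: ae0].
  move=> [Lg g0]; apply: (closed_subspace_ae cV V0 Lg).
  by apply: filterS g0 => x ->.
move=> /existsNP[g /not_implyP[Vg g0]]; right.
have [gR gI _] := VL _ Vg.
pose A : set (words hN) := [set x | g x != 0].
have mA : measurable A.
  have -> : A = ~` ((@sqnormc R \o g) @^-1` [set 0]).
    apply/seteqP; split => x /=.
      by move=> gx /eqP; rewrite sqnormc_eq0; apply/negP.
    by move=> /eqP; rewrite sqnormc_eq0.
  apply: measurableC; rewrite -[X in measurable X]setTI.
  exact: (measurable_sqnormc gR gI).
have fA : filled V A by exact: (filled_nonzero data muP qsT cV VS VSadj mA Vg).
have [B [mB fB AB sB]] := filled_saturation data muP qsT cV VS VSadj mA fA.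
(* If [B] were null, [g], which vanishes outside [A] and hence outside [B], would be zero almost
   everywhere. *)
have [B0|B0] := erg B mB sB.
  exfalso; apply: g0; exists B; split => //.
  by move=> x /= gx; apply: AB; apply/eqP.
apply/seteqP; split => f Lf; first exact: VL.
(* [f] differs from its cut to [B] only on the complement of [B], which is null. *)
apply: (@closed_subspace_ae _ _ _ _ _ cV (cut B f)) => //.
  apply: (closed_subspaceM cV _ fB) => [C h mC Vh||x].
  - exact: (invariant_cut data muP qsT cV VS VSadj).
  - exact: L2fun_cut.
  - by rewrite /cut; case: ifP => // _ /eqP; rewrite oner_eq0.
exists (~` B); split => //; first exact: measurableC.
move=> x /= fx Bx; apply: fx; rewrite /cut mem_set//.
Qed.

Theorem theorem3p8 (R : realType) (N : nat) (hN : (2 <= N)%N)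
    (lambda : 'rV[R]_N) (T : nat -> 'M[R]_N)
    (mu : probability (words hN) R) :
  markov_data lambda T ->
  markov_measure lambda T mu ->
  quasi_stationary hN T ->
  ergodic mu (@word_shift N hN) /\
  irreducible_family mu (@markov_S R N hN lambda T).
Proof.
move=> data muP qsT; have [_ T1 T0 _] := data.
have [c c0 cT] := quasi_stationary_ge T0 qsT.
have erg := markov_ergodic data muP c0 cT.
by split => //; exact: markov_irreducible.
Qed.
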